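(* For $m\in\mathbb N$, $\theta\in\mathbb R^m$ and $a\in[-1,1]^m$, let $\mathrm{FDR}_{\theta,a}(\mathrm{BH}_q)$ denote the FDR of the level-$q$ Benjamini–Hochberg procedure applied to the one-sided $p$-values $P_i=\overline\Phi(T_i)$ for $H_i:\theta_i\le0$ under the common-factor model $$T_i=\theta_i+a_iZ+\sqrt{1-a_i^2}\,\varepsilon_i,\qquad 1\le i\le m,$$ with $Z,\varepsilon_1,\dots,\varepsilon_m$ i.i.d. standard normal. Then, as $q\downarrow0$, $$\sup_{m\in\mathbb N,\ \theta\in\mathbb R^m,\ a\in[-1,1]^m}\mathrm{FDR}_{\theta,a}(\mathrm{BH}_q)=\frac{q\sqrt{\log(1/q)}}{\sqrt\pi}+O(q).$$ Thus the leading constant $1/\sqrt\pi$ (the one appearing in the expansion $\ell_{\le}(q)=q\sqrt{\log(1/q)}/\sqrt\pi+q/2+o(q)$) is optimal in the common-factor class, i.e. it is the exact leading constant of this supremum.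
   Context: $\Phi$ is the standard normal CDF and $\overline\Phi=1-\Phi$; $\ell_{\le}(q)=\frac{q\sqrt{\log(1/q)}}{\sqrt\pi}+\frac q2+\overline\Phi(\sqrt{2\log(1/q)})$ for $0<q<1$. $H_i$ is a true null iff $\theta_i\le0$. Benjamini–Hochberg procedure at level $q$ ($\mathrm{BH}_q$): given $p$-values $P_1,\dots,P_m$ with order statistics $P_{(1)}\le\dots\le P_{(m)}$, put $R=\max\{1\le k\le m: P_{(k)}\le qk/m\}$ ($R=0$ if the set is empty) and reject the hypotheses corresponding to $P_{(1)},\dots,P_{(R)}$. If $V$ is the number of rejected true nulls, $\mathrm{FDP}=V/(R\vee1)$ and $\mathrm{FDR}=\mathbb E(\mathrm{FDP})$. *)

(* Defs.v *)
From HB Require Import structures.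
From mathcomp Require Import all_boot all_order all_algebra.
From mathcomp Require Import all_classical all_reals all_analysis.

Set Implicit Arguments.
Unset Strict Implicit.
Unset Printing Implicit Defensive.

Import Order.TTheory GRing.Theory Num.Theory.
Import numFieldNormedType.Exports.

Local Open Scope classical_set_scope.
Local Open Scope ring_scope.

Section iid_prob.
Context {d : measure_display} {T : measurableType d} {R : realType}.

Definition tuple_cons n (x : T * n.-tuple T) : n.+1.-tuple T :=
  [tuple of x.1 :: x.2].

Lemma measurable_tuple_cons n : measurable_fun [set: T * n.-tuple T] (@tuple_cons n).
Proof.
exact: (measurable_cons measurable_fst measurable_snd).
Qed.

HB.instance Definition _ n := isMeasurableFun.Build _ _ _ _ (@tuple_cons n)
  (@measurable_tuple_cons n).

(* The n-fold product of P, on n.-tuple T: under it the coordinates are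
   independent with law P, see iid_prob_box. *)
Fixpoint iid_prob (P : probability T R) n : probability (n.-tuple T) R :=
  match n with
  | 0 => \d_[tuple]
  | n'.+1 => distribution (P \x iid_prob P n')%E (@tuple_cons n')
  end.

Lemma iid_prob_box (P : probability T R) n (A : 'I_n -> set T) :
  (forall i, measurable (A i)) ->
  iid_prob P n [set x | forall i, A i (tnth x i)] = (\prod_(i < n) P (A i))%E.
Proof.
elim: n A => [|n IH] A mA /=.
  rewrite big_ord0 diracE mem_set//= => -[]//.
rewrite /distribution /pushforward big_ord_recl -IH//.
rewrite (_ : _ @^-1` _ =
    A ord0 `*` [set x | forall i, A (lift ord0 i) (tnth x i)]).
  rewrite product_measure1E//.
  rewrite (_ : [set x | _] = \bigcap_(i in [set: 'I_n])
      ((fun x => tnth x i) @^-1` A (lift ord0 i))).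
    apply: fin_bigcap_measurable => // i _.
    rewrite -[X in measurable X]setTI; exact: measurable_tnth.
  by apply/seteqP; split=> x /= h i; [move=> _; exact: h|exact: (h i)].
apply/seteqP; split=> -[x y] /= h.
  split; first by have := h ord0; rewrite (tnth_nth x).
  by move=> i; have := h (lift ord0 i); rewrite tnthS/=.
by case: h => h0 h i; case: (unliftP ord0 i) => [j ->|->//]; rewrite tnthS.
Qed.

End iid_prob.

Section gaussian.
Context {R : realType}.

Definition std_normal : probability (measurableTypeR R) R := normal_prob 0 1.

Definition Phi (x : R) : R := fine (std_normal [set` `]-oo, x]]).

Definition Phibar (x : R) : R := 1 - Phi x.

Definition ell_le (q : R) : R :=
  q * Num.sqrt (ln q^-1) / Num.sqrt pi + q / 2
  + Phibar (Num.sqrt (2 * ln q^-1)).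

End gaussian.

Section BH.
Context {R : realType} (q : R) {m : nat} (p : 'I_m -> R).

(* The tie-breaking rule is immaterial: if q > 0 and the procedure makes k
   rejections with 0 < k < m, then P_(k) <= q k / m < q (k + 1) / m < P_(k+1). *)
Definition BH_order : seq 'I_m := sort (fun i j => p i <= p j) (enum 'I_m).

(* P_(k), for 1 <= k <= m *)
Definition order_stat (k : nat) : R := nth 0 [seq p i | i <- BH_order] k.-1.

Definition BH_nrej : nat :=
  \max_(1 <= k < m.+1 | order_stat k <= q * k%:R / m%:R) k.

Definition BH_rejected : seq 'I_m := take BH_nrej BH_order.

End BH.

Section FDR.
Context {R : realType}.

Definition FDP (q : R) m (theta p : 'I_m -> R) : R :=
  (count (fun i => theta i <= 0) (BH_rejected q p))%:R
  / (maxn (BH_nrej q p) 1)%:R.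

(* The joint law of (Z, (eps_1, ..., eps_m)); the FDR depends on Z and the
   eps_i only through it. *)
Definition cf_law m : probability (measurableTypeR R * m.-tuple (measurableTypeR R))%type R :=
  (std_normal \x iid_prob std_normal m)%E.

Definition cf_stat m (theta a : 'I_m -> R) (w : R * m.-tuple R) (i : 'I_m) : R :=
  theta i + a i * w.1 + Num.sqrt (1 - a i ^+ 2) * tnth w.2 i.

Definition cf_pval m (theta a : 'I_m -> R) (w : R * m.-tuple R) (i : 'I_m) : R :=
  Phibar (cf_stat theta a w i).

Definition FDR (q : R) m (theta a : 'I_m -> R) : R :=
  fine ('E_(cf_law m)[fun w => FDP q theta (cf_pval theta a w)])%E.

Definition sup_FDR (q : R) : R :=
  sup [set x | exists (m : nat) (theta a : 'I_m -> R),
    [/\ (0 < m)%N, forall i, -1 <= a i <= 1 & x = FDR q theta a]].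

End FDR.

(* Main.v *)
(**
Conditionally on Z the p-values are independent. Writing R_i for the number of
rejections when P_i is replaced by 0, leave-one-out gives
  E[FDP | Z] = sum_(i null) E[F_(i,Z)(q R_i / m) / R_i | Z],
where F_(i,z) is the conditional distribution function of P_i, so everything
rests on the ratio F_(i,z)(t) / t for t <= q. With a^2 + s^2 = 1 and phi the
normal density, phi(z) times the likelihood ratio at u of N(a z, s^2) against
N(0, 1) is the density at z of N(a u, s^2).

Upper bound: let Phibar x = q. The event |Z| >= x costs at most 2 q. On |Z| < x
the ratio, weighted by phi(z), is at most the density of N(a x, s^2) at z,
except for z between a x and x (a >= 0), an interval of length (1 - a) x on which
it is at most the peak 1 / (s sqrt(2 pi)). Since (1 - a) / s <= 1, integrating
over z gives FDR <= q (3 + x / sqrt(2 pi)), and x <= zeta := sqrt(2 log(1/q)).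

Lower bound: for u = z / a the ratio is at least exp(z^2 / 2), which is
1 / sqrt(2 pi) after weighting. A small proportion of false nulls, driven by - Z
alone, makes the BH threshold follow u = z / a for all z in [1, zeta - 1].
The threshold can exceed this level only if true nulls form half of the
rejections, which by the upper estimate has conditional probability
O(q exp(z^2 / 2)) = O(1 / zeta). Hence FDR >= q (zeta - 12) / sqrt(2 pi).
*)

Require Import Defs.
From mathcomp Require Import all_boot all_order all_algebra.
From mathcomp Require Import all_classical all_reals all_analysis.
From mathcomp Require Import measurable_realfun ring lra.

Set Implicit Arguments.
Unset Strict Implicit.
Unset Printing Implicit Defensive.

Import Order.TTheory GRing.Theory Num.Theory.
Import numFieldNormedType.Exports.

Local Open Scope classical_set_scope.
Local Open Scope ring_scope.

(** * Gaussian tails *)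

Section gaussian_tail.
Context {R : realType}.
Local Notation mu := (@lebesgue_measure R).
Local Notation pdf := (@normal_pdf R).
Implicit Types (x b s z t u d a q : R).

Lemma Phibar_pdf x : (Phibar x)%:E = (\int[mu]_(u in `[x, +oo[) (pdf 0 1 u)%:E)%E.
Proof.
rewrite -integral_itv_obnd_cbnd; last first.
  by apply/measurable_EFinP/measurable_funTS; exact: measurable_normal_pdf.
rewrite /Phibar /Phi.
have h : (std_normal [set` `]-oo, x]] + std_normal [set` `]x, +oo[] = (1 : \bar R))%E.
  rewrite -measureU//.
    rewrite -(@probability_setT _ _ _ (@std_normal R)).
    by congr (std_normal _); rewrite -setCitvl setUv.
  by rewrite -setCitvl setICr.
have fin1 : (std_normal `]-oo, x]%classic : \bar R) \is a fin_num by exact: fin_num_measure.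
have fin2 : (std_normal `]x, +oo[%classic : \bar R) \is a fin_num by exact: fin_num_measure.
transitivity (std_normal `]x, +oo[%classic : \bar R); last by [].
by rewrite EFinB fineK// -[X in (X - _)%E]h addeAC subee// add0e.
Qed.

Lemma pdf1E u : pdf 0 1 u = (Num.sqrt (pi *+ 2))^-1 * expR (- u ^+ 2 / 2).
Proof.
rewrite normal_pdfE ?oner_eq0// /normal_peak /normal_fun expr1n mul1r subr0.
by [].
Qed.

Lemma pdf_affine b s x : 0 < s -> pdf b s x = pdf 0 1 ((x - b) / s) / s.
Proof.
move=> s0; rewrite normal_pdfE ?gt_eqF// pdf1E /normal_peak /normal_fun.
rewrite -mulrnAr sqrtrM ?sqr_ge0// sqrtr_sqr gtr0_norm// invfM [RHS]mulrAC.
rewrite [s^-1 * _]mulrC; congr (_ * expR _).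
by rewrite expr_div_n -mulr_natr; field; rewrite gt_eqF.
Qed.

Lemma Phibar_affine b s x : 0 < s ->
  (Phibar ((x - b) / s))%:E = (\int[mu]_(u in `[x, +oo[) (pdf b s u)%:E)%E.
Proof.
move=> s0; rewrite Phibar_pdf.
pose F (u : R^o) : R^o := (u - b) / s.
have F'E : F^`()%classic = cst s^-1.
  apply/funext => y; rewrite /F derive1E deriveM// deriveD// derive_cst scaler0.
  by rewrite add0r derive_id derive_cst addr0 scaler1.
rewrite (@increasing_ge0_integration_by_substitutiony _ F)//.
- by apply: eq_integral => y _; rewrite F'E !fctE /F -pdf_affine.
- by move=> u v _ _ uv; rewrite /F ltr_pM2r ?invr_gt0// ltr_leB.
- by rewrite F'E => ? _; exact: cvg_cst.
- by rewrite F'E; exact: is_cvg_cst.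
- by rewrite F'E; exact: is_cvg_cst.
- split; first by move=> u _; apply: derivableM; [exact: derivableD|exact: derivable_cst].
  apply: cvg_at_right_filter. apply: (@continuousM R R^o (fun u => u - b) (cst s^-1)).
    by apply: continuousB => //; exact: cst_continuous.
  exact: cst_continuous.
- apply/gt0_cvgMly; last exact: cvg_addrr.
  by rewrite invr_gt0.
- by apply: continuous_subspaceT; exact: continuous_normal_pdf.
- by move=> u _; rewrite normal_pdf_ge0.
Qed.

Lemma Phibar_ge0 x : 0 <= Phibar x.
Proof.
rewrite -lee_fin Phibar_pdf; apply: integral_ge0 => u _.
by rewrite lee_fin normal_pdf_ge0.
Qed.

Lemma Phibar_le x u : x <= u -> Phibar u <= Phibar x.
Proof.
move=> xu; rewrite -lee_fin !Phibar_pdf; apply: ge0_subset_integral => //.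
- by apply/measurable_EFinP/measurable_funTS; exact: measurable_normal_pdf.
- by move=> y _; rewrite lee_fin normal_pdf_ge0.
- by apply: subset_itvr; rewrite bnd_simp.
Qed.

(** Integrating a pointwise bound on the density ratio beyond [x]. All likelihood-ratio estimates on
    p-values pass through this comparison. *)
Lemma tail_comparison b s (B : R) x : 0 < s -> 0 <= B ->
  (forall u, x <= u -> pdf b s u <= B * pdf 0 1 u) ->
  Phibar ((x - b) / s) <= B * Phibar x.
Proof.
move=> s0 B0 h; rewrite -lee_fin Phibar_affine// EFinM Phibar_pdf.
rewrite -ge0_integralZl_EFin//.
- apply: ge0_le_integral => //.
  + by move=> u _; rewrite lee_fin normal_pdf_ge0.
  + by apply/measurable_EFinP/measurable_funTS; exact: measurable_normal_pdf.
  + apply/measurable_EFinP/measurable_funM => //.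
    by apply: measurable_funTS; exact: measurable_normal_pdf.
  + by move=> u; rewrite /= in_itv/= andbT => xu; rewrite -EFinM lee_fin h.
- by move=> u _; rewrite lee_fin normal_pdf_ge0.
- by apply/measurable_EFinP/measurable_funTS; exact: measurable_normal_pdf.
Qed.

(** The density at v of N(-d, 1) relative to N(0, 1) is exp(- v d - d^2 / 2), which for v >= u is
    largest at v = u. *)
Lemma Phibar_shift u d : 0 <= d ->
  Phibar (u + d) <= expR (- (u * d) - d ^+ 2 / 2) * Phibar u.
Proof.
move=> d0; have := @tail_comparison (- d) 1 (expR (- (u * d) - d ^+ 2 / 2)) u ltr01 (expR_ge0 _).
rewrite divr1 opprK; apply => v uv.
rewrite (@pdf_affine (- d) 1)// !divr1 !pdf1E mulrCA -expRD opprK.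
rewrite ler_wpM2l ?invr_ge0 ?sqrtr_ge0// ler_expR.
suff : u * d <= v * d by lra.
by rewrite ler_wpM2r.
Qed.


Lemma Phibar_sub_le x y (c : R) : x <= y ->
  (forall u, x <= u -> pdf 0 1 u <= c) -> Phibar x - Phibar y <= (y - x) * c.
Proof.
move=> xy h; have c0 : 0 <= c by apply: le_trans (h x (lexx _)); exact: normal_pdf_ge0.
rewrite lerBlDr -lee_fin [in leRHS]EFinD !Phibar_pdf.
have -> : `[x, +oo[%classic = `[x, y[ `|` `[y, +oo[ :> set R.
  by rewrite -itv_bndbnd_setU// ?bnd_simp.
rewrite ge0_integral_setU//; last 3 first.
- by apply/measurable_EFinP/measurable_funTS; exact: measurable_normal_pdf.
- by move=> u _; rewrite lee_fin normal_pdf_ge0.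
- apply/disj_setPS => u [] /=; rewrite !in_itv/= andbT => /andP[_ uy] yu.
  by have := lt_le_trans uy yu; rewrite ltxx.
apply: leeD => //.
apply: (@le_trans _ _ (\int[mu]_(u in `[x, y[) (c%:E))%E).
  apply: ge0_le_integral => //.
  + by move=> u _; rewrite lee_fin normal_pdf_ge0.
  + by apply/measurable_EFinP/measurable_funTS; exact: measurable_normal_pdf.
  + by move=> u /=; rewrite in_itv/= => /andP[xu _]; rewrite lee_fin h.
rewrite integral_cst//= lebesgue_measure_itv/= lte_fin.
by case: ltP => [_|_]; rewrite ?mule0 ?lee_fin ?mulr_ge0 ?subr_ge0// mulrC.
Qed.

Lemma pdf1_le u : pdf 0 1 u <= (Num.sqrt (pi *+ 2))^-1.
Proof.
rewrite pdf1E ler_piMr ?invr_ge0 ?sqrtr_ge0// expR_le1.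
by have := sqr_ge0 u; lra.
Qed.

Lemma continuous_Phibar : continuous (@Phibar R).
Proof.
move=> x; apply/cvgrPdist_le => e e0.
pose c := (Num.sqrt ((pi : R) *+ 2))^-1.
have c0 : 0 < c by rewrite invr_gt0 sqrtr_gt0 pmulrn_lgt0// pi_gt0.
have L u v : `|Phibar u - Phibar v| <= `|u - v| * c.
  wlog uv : u v / u <= v.
    by move=> H; case/orP: (le_total u v) => /H//; rewrite distrC [X in _ <= X * _]distrC.
  rewrite ger0_norm ?subr_ge0 ?Phibar_le// (distrC u) ger0_norm ?subr_ge0//.
  by apply: Phibar_sub_le => // w _; exact: pdf1_le.
near=> y; apply: le_trans (L _ _) _.
rewrite -ler_pdivlMr//.
near: y; apply: (@cvgr_dist_le _ R^o); last exact: divr_gt0.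
exact: cvg_id.
Unshelve. all: by end_near. Qed.

Lemma Phibar_opp x : Phibar (- x) = 1 - Phibar x.
Proof.
suff : Phibar x = Phi (- x) by rewrite /Phibar => ->.
apply: EFin_inj; rewrite Phibar_pdf /Phi fineK; last exact: fin_num_measure.
transitivity (\int[mu]_(u in `]-oo, (- x)%R]) (pdf 0 1 u)%:E)%E => //.
rewrite ge0_integration_by_substitutionNy//.
- by apply: eq_integral => u _; rewrite /= !pdf1E sqrrN.
- by apply: continuous_subspaceT; exact: continuous_normal_pdf.
- by move=> u _; exact: normal_pdf_ge0.
Qed.

Lemma Phibar0 : Phibar 0 = 2^-1 :> R.
Proof. by have := Phibar_opp 0; rewrite oppr0; lra. Qed.

Lemma Phibar_le_exp x : 0 <= x -> Phibar x <= expR (- x ^+ 2 / 2).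
Proof.
move=> x0; have := Phibar_shift 0 x0; rewrite add0r mul0r oppr0 sub0r.
rewrite Phibar0 mulNr => /le_trans; apply.
by rewrite ler_piMr ?expR_ge0//; lra.
Qed.

Lemma Phibar_quantile t : 0 < t <= 2^-1 -> exists2 x, 0 <= x & Phibar x = t.
Proof.
move=> /andP[t0 t2].
(* Far enough out: exp(M^2 / 2) >= 1 + 2 / t^2 >= 1 / t, so the tail at M is at most t. *)
pose M := 2 * t^-1.
have M0 : 0 <= M by rewrite mulr_ge0// invr_ge0 ltW.
have PM : Phibar M <= t.
  apply: le_trans (Phibar_le_exp M0) _.
  rewrite mulNr expRN -[leRHS]invrK lef_pV2 ?posrE ?expR_gt0 ?invr_gt0//.
  apply: le_trans (expR_ge1Dx _).
  have ti1 : 1 <= t^-1 by rewrite -invr1 lef_pV2 ?posrE//; lra.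
  by rewrite /M; nra.
have [|x] := @IVT R (@Phibar R) 0 M t M0 (continuous_subspaceT continuous_Phibar).
  rewrite Phibar0; apply/andP; split.
    by rewrite ge_min PM orbT.
  by rewrite le_max t2.
by rewrite in_itv/= => /andP[x0 _] <-; exists x.
Qed.

(* The joint density of [(Z, a Z + s e)] at [(z, u)] is symmetric. *)
Lemma joint_pdf_sym a s z u : 0 < s -> a ^+ 2 + s ^+ 2 = 1 ->
  pdf 0 1 z * pdf (a * z) s u = pdf 0 1 u * pdf (a * u) s z.
Proof.
move=> s0 as1; rewrite !(pdf_affine _ _ s0) !pdf1E.
set c := (Num.sqrt _)^-1.
rewrite (_ : c * _ * _ = c * c / s *
  (expR (- z ^+ 2 / 2) * expR (- ((u - a * z) / s) ^+ 2 / 2))); last by ring.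
rewrite [RHS](_ : _ = c * c / s *
  (expR (- u ^+ 2 / 2) * expR (- ((z - a * u) / s) ^+ 2 / 2))); last by ring.
rewrite -!expRD; congr (_ * expR _).
rewrite !expr_div_n.
have s2 : s ^+ 2 = 1 - a ^+ 2 by lra.
have s2n : 1 - a ^+ 2 != 0 by rewrite -s2 expf_neq0// gt_eqF.
by rewrite s2; field.
Qed.

Lemma pdf_le_peak b s x : 0 < s -> pdf b s x <= (Num.sqrt (pi *+ 2))^-1 / s.
Proof. by move=> s0; rewrite pdf_affine// ler_pM2r ?invr_gt0// pdf1_le. Qed.

Lemma pdf1_gt0 x : 0 < pdf 0 1 x.
Proof. by rewrite pdf1E mulr_gt0 ?expR_gt0// invr_gt0 sqrtr_gt0 pmulrn_lgt0// pi_gt0. Qed.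

(** By symmetry of the joint density, phi(z) times the left side is phi(u) times a density of
    standard deviation s, hence at most phi(u) peak / s; and peak = phi(z) exp(z^2 / 2). *)
Lemma pdf_le_expM a s z u : 0 < s -> a ^+ 2 + s ^+ 2 = 1 ->
  pdf (a * z) s u <= expR (z ^+ 2 / 2) / s * pdf 0 1 u.
Proof.
move=> s0 as1; rewrite -(ler_pM2l (pdf1_gt0 z)) joint_pdf_sym// mulrCA [leRHS]mulrC -mulrA.
rewrite [leRHS](_ : _ = pdf 0 1 u * (pdf 0 1 z * expR (z ^+ 2 / 2) / s)); last by ring.
rewrite ler_wpM2l ?normal_pdf_ge0//.
have -> : pdf 0 1 z * expR (z ^+ 2 / 2) = (Num.sqrt (pi *+ 2))^-1.
  by rewrite pdf1E -mulrA -expRD mulNr addNr expR0 mulr1.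
exact: pdf_le_peak.
Qed.

Lemma Phibar_tilt_le a s z x : 0 < s -> a ^+ 2 + s ^+ 2 = 1 ->
  Phibar ((x - a * z) / s) <= expR (z ^+ 2 / 2) / s * Phibar x.
Proof.
move=> s0 as1; apply: tail_comparison => //.
  by rewrite mulr_ge0 ?expR_ge0 ?invr_ge0 ?ltW.
by move=> u _; exact: pdf_le_expM.
Qed.

(** With a = 4/5, s = 3/5 and z = 5 x / 4, the tilted tail at x is [Phibar 0], which is 1/2, and it
    is at most a constant times [Phibar x]. *)
Lemma Phibar_gt0 x : 0 < Phibar x.
Proof.
have s0 : (0 : R) < 3 / 5 by lra.
have := @Phibar_tilt_le (4 / 5) (3 / 5) (x * (5 / 4)) x s0.
rewrite (_ : x - _ = 0); last by field.
rewrite mul0r Phibar0 => /(_ ltac:(field)) h.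
rewrite lt_neqAle Phibar_ge0 andbT eq_sym; apply/eqP => p0.
by move: h; rewrite p0 mulr0; lra.
Qed.


(** On the positive side the factor in [Phibar_shift] is below 1; reflection gives the negative
    side, and 0 separates the mixed case. *)
Lemma Phibar_ltW x y : x < y -> Phibar y < Phibar x.
Proof.
have pos u v : 0 <= u -> u < v -> Phibar v < Phibar u.
  move=> u0 uv; have d0 : 0 <= v - u by rewrite subr_ge0 ltW.
  have := Phibar_shift u d0; rewrite subrKC => /le_lt_trans; apply.
  rewrite gtr_pMl ?Phibar_gt0// expR_lt1.
  have : 0 <= u * (v - u) by rewrite mulr_ge0.
  have : 0 < (v - u) ^+ 2 by rewrite exprn_gt0// subr_gt0.
  lra.
move=> xy; have [x0|x0] := leP 0 x; first exact: pos.
have neg u v : v <= 0 -> u < v -> Phibar v < Phibar u.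
  move=> v0 uv; rewrite -(opprK u) -(opprK v) !(Phibar_opp (- _)).
  by rewrite ltrD2l ltrN2 pos ?oppr_ge0// ltrN2.
have [y0|y0] := leP y 0; first exact: neg.
by apply: lt_trans (pos _ _ (lexx _) y0) (neg _ _ (lexx _) x0).
Qed.

Lemma Phibar_leP x y : (Phibar x <= Phibar y) = (y <= x).
Proof.
have [yx|xy] := leP y x; first by rewrite Phibar_le.
by apply/negbTE; rewrite -ltNge Phibar_ltW.
Qed.

Lemma std_normal_tail x : std_normal `[x, +oo[%classic = (Phibar x)%:E.
Proof. by rewrite Phibar_pdf. Qed.

Lemma std_normal_two_tails x :
  (std_normal [set z : R | (x <= `|z|)%R] <= (2 * Phibar x)%:E)%E.
Proof.
apply: (@le_trans _ _ (std_normal (`]-oo, (- x)] `|` `[x, +oo[ : set R))).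
  apply: le_measure; rewrite ?inE//.
  - rewrite (_ : [set _ | _] = (fun z : R => `|z|) @^-1` `[x, +oo[).
      by rewrite -[X in measurable X]setTI; exact: normr_measurable.
    by apply/seteqP; split => z /=; rewrite in_itv/= andbT.
  - exact: measurableU.
  - move=> z /=; rewrite !in_itv/= andbT.
    by case: (ger0P z) => _ h; [right|left; rewrite lerNr].
apply: (@le_trans _ _ (std_normal `]-oo, (- x)%R]%classic + std_normal `[x, +oo[%classic)%E).
  exact: measureU2.
rewrite std_normal_tail (_ : std_normal _ = (Phi (- x))%:E); last first.
  by rewrite /Phi fineK// fin_num_measure.
rewrite -EFinD lee_fin (_ : Phi (- x) = 1 - Phibar (- x)); last first.
  by rewrite /Phibar; ring.
by rewrite Phibar_opp; lra.
Qed.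

(** A step of length 1 / x at least halves the tail, since exp(-1) <= 1/2. So the tail is at most
    twice the mass of [x, x + 1/x], on which the density is at most its value at x. *)
Lemma Phibar_Mills x : 0 < x -> x * Phibar x <= 2 * pdf 0 1 x.
Proof.
move=> x0; have d0 : 0 <= x^-1 by rewrite invr_ge0 ltW.
have h1 := Phibar_shift x d0.
have h2 : Phibar x - Phibar (x + x^-1) <= x^-1 * pdf 0 1 x.
  have := @Phibar_sub_le x (x + x^-1) (pdf 0 1 x).
  rewrite lerDl [x + x^-1 - x]addrAC subrr add0r; apply => // u xu.
  rewrite !pdf1E ler_wpM2l ?invr_ge0 ?sqrtr_ge0// ler_expR.
  have : x ^+ 2 <= u ^+ 2 by rewrite lerXn2r// nnegrE ltW// (lt_le_trans x0).
  by lra.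
have h3 : expR (- (x / x) - x^-1 ^+ 2 / 2) <= 2^-1.
  rewrite divff ?gt_eqF//.
  apply: (@le_trans _ _ (expR (- 1))).
    by rewrite ler_expR; have := sqr_ge0 x^-1; lra.
  rewrite expRN lef_pV2 ?posrE ?expR_gt0//.
  by have := @expR_ge1Dx R 1; lra.
have h4 : Phibar (x + x^-1) <= 2^-1 * Phibar x.
  by apply: le_trans h1 _; rewrite ler_wpM2r// Phibar_ge0.
have h5 : Phibar x <= 2 * (x^-1 * pdf 0 1 x) by lra.
rewrite -ler_pdivlMl// (le_trans h5)//.
by rewrite mulrCA.
Qed.

End gaussian_tail.

(** * The Benjamini-Hochberg procedure *)

(** [P] is closed downwards along the order, so in a sorted list the elements satisfying it form an
    initial segment. *)
Lemma sorted_filter_take (T : Type) (leT : rel T) (P : pred T) (s : seq T) :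
  transitive leT -> (forall x y, leT x y -> P y -> P x) -> sorted leT s ->
  seq.filter P s = take (count P s) s.
Proof.
move=> tr dP; elim: s => //= x s IH xs.
have [Px|nPx] /= := boolP (P x).
  by congr (_ :: _); apply: IH; exact: path_sorted xs.
have hs : all (predC P) s.
  apply: sub_all (order_path_min tr xs) => y xy /=.
  by apply: contra nPx; exact: dP.
rewrite add0n; have -> : count P s = 0%N.
  by apply/eqP; rewrite -leqn0 leqNgt -has_count; rewrite -all_predC.
by apply/nilP; rewrite /nilp size_filter -leqn0 leqNgt -has_count -all_predC.
Qed.

Lemma sorted_nth_count (T : Type) (x0 : T) (leT : rel T) (P : pred T) (s : seq T) k :
  transitive leT -> (forall x y, leT x y -> P y -> P x) -> sorted leT s ->
  (k < size s)%N -> P (nth x0 s k) = (k < count P s)%N.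
Proof.
move=> tr dP ss ks; have e := sorted_filter_take tr dP ss.
have [kc|kc] := ltnP k (count P s).
  have : all P (seq.filter P s) by exact: filter_all.
  by rewrite e => /(all_nthP x0)/(_ k); rewrite size_takel ?count_size// nth_take//; exact.
apply/negbTE/negP => Pk.
have : seq.filter P s = seq.filter P s ++ seq.filter P (drop (count P s) s).
  by rewrite -{1}(cat_take_drop (count P s) s) filter_cat -e filter_id.
move=> /(congr1 size); rewrite size_cat -[LHS]addn0 => /addnI /esym/eqP.
rewrite size_filter -leqn0 leqNgt -has_count => /negP; apply.
apply/(has_nthP x0); exists (k - count P s)%N.
  by rewrite size_drop ltn_sub2r// (leq_ltn_trans kc).
by rewrite nth_drop subnKC.
Qed.

Section BH_deterministic.
Context {R : realType} (q : R) {m : nat}.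
Implicit Types (p : 'I_m -> R) (c : R) (i : 'I_m).

Definition npval_le p c : nat := #|[pred j | p j <= c]|.

Lemma npval_le_count p c : npval_le p c = count (fun j => p j <= c) (BH_order p).
Proof.
rewrite /npval_le cardE size_filter -enumT.
by rewrite /BH_order (permP (permEl (perm_sort _ _))).
Qed.

Let leP_trans p : transitive (fun i j : 'I_m => p i <= p j).
Proof. by move=> x y z; exact: le_trans. Qed.

Lemma BH_order_sorted p : sorted (fun i j => p i <= p j) (BH_order p).
Proof. by apply: sort_sorted => i j; exact: le_total. Qed.

Lemma size_BH_order p : size (BH_order p) = m.
Proof. by rewrite size_sort size_enum_ord. Qed.

(** Order statistics and the counting function are inverse to each other; through this equivalence
    the procedure is analysed by counts alone. *)
Lemma order_stat_le p c k : (0 < k <= m)%N ->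
  (order_stat p k <= c) = (k <= npval_le p c)%N.
Proof.
move=> /andP[k0 km]; have i0 : 'I_m by exact: Ordinal (leq_trans k0 km).
have km' : (k.-1 < size (BH_order p))%N by rewrite size_BH_order prednK.
rewrite /order_stat (nth_map i0)// npval_le_count.
rewrite (@sorted_nth_count _ i0 (fun i j => p i <= p j) (fun j => p j <= c))//.
- by rewrite prednK.
- by move=> x y; exact: le_trans.
- exact: BH_order_sorted.
Qed.

Lemma BH_nrej_ge p k : (0 < k <= m)%N ->
  (k <= npval_le p (q * k%:R / m%:R))%N -> (k <= BH_nrej q p)%N.
Proof.
move=> km h; rewrite /BH_nrej.
apply: (leq_bigmax_seq (F := id)); first by rewrite mem_index_iota ltnS.
by rewrite order_stat_le.
Qed.

Lemma BH_nrejP p : (BH_nrej q p <= m)%N /\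
  (BH_nrej q p <= npval_le p (q * (BH_nrej q p)%:R / m%:R))%N.
Proof.
(* [Q] holds at 0 and is stable under [maxn], which covers the empty maximum as well. *)
pose Q (r : nat) := (r <= m)%N /\ (r <= npval_le p (q * r%:R / m%:R))%N.
suff : Q (BH_nrej q p) by [].
rewrite /BH_nrej big_seq_cond; apply: (big_ind Q) => //.
- by move=> x y; rewrite /maxn; case: ifP.
- move=> k /andP[]; rewrite mem_index_iota ltnS => km.
  by rewrite order_stat_le// => h; split=> //; case/andP: km.
Qed.

Lemma npval_le_mono p c c' : c <= c' -> (npval_le p c <= npval_le p c')%N.
Proof.
move=> cc; apply: subset_leq_card; apply/fintype.subsetP => j; rewrite !inE => h.
exact: le_trans cc.
Qed.

(** If more than R p-values lay below q R / m, their number k > R would itself qualify, because the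
    level q k / m is larger still. *)
Lemma npval_le_nrej p : 0 < q -> npval_le p (q * (BH_nrej q p)%:R / m%:R) = BH_nrej q p.
Proof.
move=> q0; have [h1 h2] := BH_nrejP p; apply/eqP; rewrite eqn_leq h2 andbT.
rewrite leqNgt; apply/negP; set k := npval_le _ _ => h.
have km : (k <= m)%N by rewrite -[leqRHS]card_ord max_card.
have : (k <= BH_nrej q p)%N.
  apply: BH_nrej_ge; first by rewrite km (leq_ltn_trans _ h).
  apply: npval_le_mono; rewrite ler_wpM2r ?invr_ge0 ?ler0n// ler_wpM2l ?(ltW q0)//.
  by rewrite ler_nat ltnW.
by rewrite leqNgt h.
Qed.

(** Exactly R p-values lie below q R / m, so the first R in sorted order are the ones under this
    threshold, and the sorting disappears. *)
Lemma FDP_sum (theta p : 'I_m -> R) : 0 < q ->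
  FDP q theta p = \sum_(i < m | theta i <= 0)
    (p i <= q * (BH_nrej q p)%:R / m%:R)%R%:R / (maxn (BH_nrej q p) 1)%:R.
Proof.
move=> q0; rewrite /FDP /BH_rejected -mulr_suml; congr (_ / _).
set c := q * _ / _.
rewrite -[in take _ _](npval_le_nrej p q0) npval_le_count.
rewrite -(@sorted_filter_take _ (fun i j => p i <= p j) (fun j => p j <= c))//; last 2 first.
- by move=> x y; exact: le_trans.
- exact: BH_order_sorted.
rewrite count_filter /BH_order (permP (permEl (perm_sort _ _))).
rewrite -sum1_count natr_sum big_enum_cond/=.
rewrite [RHS](big_mkcond _) [LHS]big_mkcond; apply: eq_bigr => i _ /=.
by case: (theta i <= 0); case: (p i <= c).
Qed.

(** The leave-one-out device: the number of rejections for [zero_at p i] ignores [p i], yet agrees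
    with that for [p] as soon as i is rejected. *)
Definition zero_at p i : 'I_m -> R := fun j => if j == i then 0 else p j.

Lemma npval_le_zero_at p i c : 0 <= c ->
  (npval_le p c <= npval_le (zero_at p i) c)%N.
Proof.
move=> c0; apply: subset_leq_card; apply/fintype.subsetP => j; rewrite !inE /zero_at.
by case: ifP.
Qed.

Lemma BH_nrej_zero_at_gt0 p i : 0 < q -> (0 < BH_nrej q (zero_at p i))%N.
Proof.
move=> q0; have m0 : (0 < m)%N by case: m i => [[]|].
apply: BH_nrej_ge => //; apply/card_gt0P; exists i.
by rewrite inE /zero_at eqxx mulr1 divr_ge0// ltW.
Qed.

Lemma BH_nrej_zero_at_ge p i : 0 < q ->
  (BH_nrej q p <= BH_nrej q (zero_at p i))%N.
Proof.
move=> q0; have [->//|r0] := posnP (BH_nrej q p).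
have [h1 h2] := BH_nrejP p.
apply: BH_nrej_ge; first by rewrite r0.
apply: leq_trans h2 (npval_le_zero_at _ _ _).
by rewrite divr_ge0// mulr_ge0// ltW.
Qed.

(* Both sides vanish unless [i] is rejected, and then lowering its p-value to 0
   does not change the number of rejections. *)
Lemma leave_one_out p i : 0 < q ->
  (p i <= q * (BH_nrej q p)%:R / m%:R)%R%:R / (maxn (BH_nrej q p) 1)%:R =
  (p i <= q * (BH_nrej q (zero_at p i))%:R / m%:R)%R%:R
    / (BH_nrej q (zero_at p i))%:R :> R.
Proof.
move=> q0; set r := BH_nrej q p; set r' := BH_nrej q (zero_at p i).
have rr' : (r <= r')%N by exact: BH_nrej_zero_at_ge.
have r'0 : (0 < r')%N by exact: BH_nrej_zero_at_gt0.
have back : p i <= q * r'%:R / m%:R -> r = r'.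
  move=> h; apply/eqP; rewrite eqn_leq rr'/=; apply: BH_nrej_ge.
    by rewrite r'0; have [] := BH_nrejP (zero_at p i).
  rewrite -[leqLHS](npval_le_nrej (zero_at p i) q0).
  apply: subset_leq_card; apply/fintype.subsetP => j; rewrite !inE /zero_at.
  by case: eqP => // ->.
have fwd : p i <= q * r%:R / m%:R -> p i <= q * r'%:R / m%:R.
  move=> /le_trans; apply; rewrite ler_wpM2r ?invr_ge0 ?ler0n//.
  by rewrite ler_wpM2l ?(ltW q0)// ler_nat.
have [h'|h'] := boolP (p i <= q * r'%:R / m%:R).
  by rewrite (back h') h' (maxn_idPl _).
by rewrite (_ : (p i <= _) = false) ?mul0r//; apply: contraNF h'.
Qed.

Lemma FDP_leave_one_out (theta p : 'I_m -> R) : 0 < q ->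
  FDP q theta p = \sum_(i < m | theta i <= 0)
    (p i <= q * (BH_nrej q (zero_at p i))%:R / m%:R)%R%:R
      / (BH_nrej q (zero_at p i))%:R.
Proof. by move=> q0; rewrite FDP_sum//; apply: eq_bigr => i _; exact: leave_one_out. Qed.

Lemma FDP_ge0 (theta p : 'I_m -> R) : 0 <= FDP q theta p.
Proof. by rewrite divr_ge0. Qed.

Lemma FDP_le1 (theta p : 'I_m -> R) : FDP q theta p <= 1.
Proof.
rewrite /FDP ler_pdivrMr ?mul1r ?ler_nat; last by rewrite ltr0n leq_max orbT.
apply: (leq_trans (count_size _ _)); rewrite size_take_min.
by apply: leq_trans (geq_minl _ _) _; exact: leq_maxl.
Qed.

End BH_deterministic.

(** * Resampling and conditional FDR *)

Section resampling.
Context {d : measure_display} {T : measurableType d} {R : realType}.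
Variable P : probability T R.

Definition tuple_upd n (i : 'I_n) (wy : n.-tuple T * T) : n.-tuple T :=
  [tuple if j == i then wy.2 else tnth wy.1 j | j < n].

Lemma measurable_tuple_upd n (i : 'I_n) :
  measurable_fun [set: n.-tuple T * T] (tuple_upd i).
Proof.
apply/measurable_fun_tnthP => j.
rewrite (_ : _ \o _ = fun wy => if j == i then wy.2 else tnth wy.1 j); last first.
  by apply/funext => wy /=; rewrite tnth_mktuple.
case: eqP => _; first exact: measurable_snd.
by apply: (measurableT_comp (measurable_tnth j)); exact: measurable_fst.
Qed.

Lemma tuple_upd0 n x y (w : n.-tuple T) :
  tuple_upd ord0 (tuple_cons (x, w), y) = tuple_cons (y, w).
Proof.
apply: eq_from_tnth => j; rewrite tnth_mktuple; case: (unliftP ord0 j) => [k ->|->].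
  by rewrite /= !tnthS.
by rewrite eqxx /= (tnth_nth x).
Qed.

Lemma tuple_upd_lift n (i : 'I_n) x y (w : n.-tuple T) :
  tuple_upd (lift ord0 i) (tuple_cons (x, w), y) = tuple_cons (x, tuple_upd i (w, y)).
Proof.
apply: eq_from_tnth => j; rewrite tnth_mktuple; case: (unliftP ord0 j) => [k ->|->].
  by rewrite !tnthS tnth_mktuple (inj_eq lift_inj).
by rewrite /= !(tnth_nth x).
Qed.

Lemma integral_iid_probS n (f : n.+1.-tuple T -> \bar R) :
  measurable_fun setT f -> (forall w, 0 <= f w)%E ->
  (\int[iid_prob P n.+1]_w f w = \int[P]_x \int[iid_prob P n]_w f (tuple_cons (x, w)))%E.
Proof.
move=> mf f0 /=; rewrite ge0_integral_distribution// fubini_tonelli1//; last by move=> x; exact: f0.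
by apply: measurableT_comp => //; exact: measurable_tuple_cons.
Qed.

(** The form of independence needed for leave-one-out: coordinate i can be integrated out first, the
    others being held fixed. Induction peels off the head of the tuple. *)
Lemma resample n (i : 'I_n) (f : n.-tuple T -> \bar R) :
  measurable_fun setT f -> (forall w, 0 <= f w)%E ->
  (\int[iid_prob P n]_w f w =
   \int[iid_prob P n]_w \int[P]_y f (tuple_upd i (w, y)))%E.
Proof.
elim: n i f => [[]//|n IH] i f mf f0.
have mfc x : measurable_fun setT (fun w => f (tuple_cons (x, w))).
  apply: measurableT_comp => //; apply: measurableT_comp; first exact: measurable_tuple_cons.
  exact: measurable_pair1.
have mfu : measurable_fun setT (fun w => f (tuple_upd i w)).
  by apply: measurableT_comp => //; exact: measurable_tuple_upd.
rewrite [RHS]integral_iid_probS; last 2 first.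
- exact: (measurable_fun_fubini_tonelli_F _ mfu).
- by move=> w; exact: integral_ge0.
rewrite integral_iid_probS//.
case: (unliftP ord0 i) => [j ij|i0]; last first.
  (* When i is the head, the resampled integrand no longer depends on the old head, and the outer
     integral is that of a constant. *)
  rewrite i0; under [RHS]eq_integral.
    move=> x _; under eq_integral do under eq_integral do rewrite tuple_upd0.
    over.
  set c := (\int[iid_prob P n]_w _)%E.
  transitivity c; last first.
    rewrite -[LHS]mule1 -(probability_setT P).
    by rewrite -(integral_cst P measurableT c).
  rewrite /c.
  rewrite -(@fubini_tonelli _ _ _ _ _ P (iid_prob P n) (fun xw => f (tuple_cons xw)))//.
  by apply: measurableT_comp => //; exact: measurable_tuple_cons.
apply: eq_integral => x _; rewrite (IH j)//.
by apply: eq_integral => w _; apply: eq_integral => y _; rewrite ij tuple_upd_lift.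
Qed.

End resampling.

(** * Measurability of the BH procedure *)

Section measurable_pattern.
Context {d : measure_display} {T : measurableType d} {R : realType}.

(** The function is constant on each of the finitely many atoms cut out by the events, so every
    preimage is a finite union of atoms. *)
Lemma measurable_fun_pattern (I : finType) (b : I -> T -> bool)
    (g : {set I} -> R) :
  (forall i, measurable [set w | b i w]) ->
  measurable_fun setT (fun w => g [set i | b i w]%SET).
Proof.
move=> mb _ Y mY; rewrite setTI.
rewrite (_ : _ @^-1` _ = \bigcup_(B in [set B : {set I} | Y (g B)])
   \bigcap_(i in [set: I]) (if i \in B then [set w | b i w] else ~` [set w | b i w])); last first.
  apply/seteqP; split=> w /=.
    move=> Yw; exists [set i | b i w]%SET => // i _; rewrite inE.
    by case: ifP => //= /negP.
  move=> [B YB /= Bw]; suff -> : [set i | b i w]%SET = B by [].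
  apply/setP => i; rewrite inE; have := Bw i Logic.I.
  by case: ifP => //= _ /negP/negbTE.
apply: fin_bigcup_measurable => [|B _]; first exact: finite_finset.
apply: fin_bigcap_measurable => [|i _]; first exact: finite_finset.
by case: ifP => _ //; exact: measurableC.
Qed.

End measurable_pattern.

Section measurable_BH.
Context {R : realType} (q : R) {m : nat}.

(** The outcomes of all comparisons of a p-value with a BH level. These finitely many bits determine
    both the number of rejections and the FDP. *)
Let rejection_pattern (p : 'I_m -> R) : {set 'I_m * 'I_m.+1} :=
  [set jk : 'I_m * 'I_m.+1 | p jk.1 <= q * (jk.2 : nat)%:R / m%:R]%SET.

Let pattern_nrej (B : {set 'I_m * 'I_m.+1}) : nat :=
  \max_(k < m.+1 | (0 < k)%N && (k <= #|[pred j | (j, k) \in B]|)%N) k.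

Let BH_nrej_pattern p : BH_nrej q p = pattern_nrej (rejection_pattern p).
Proof.
have N (k : 'I_m.+1) :
    #|[pred j | (j, k) \in rejection_pattern p]| = npval_le p (q * (k : nat)%:R / m%:R).
  by apply: eq_card => j; rewrite !inE.
apply/eqP; rewrite eqn_leq; apply/andP; split.
  have [h1 h2] := BH_nrejP q p; have [->//|r0] := posnP (BH_nrej q p).
  have rm : (BH_nrej q p < m.+1)%N by rewrite ltnS.
  by apply: (@leq_bigmax_cond _ _ (fun k : 'I_m.+1 => k : nat) (Ordinal rm)); rewrite r0 N.
apply/bigmax_leqP => k /andP[k0]; rewrite N => h; apply: BH_nrej_ge => //.
by rewrite k0 -ltnS ltn_ord.
Qed.

Context {d : measure_display} {T : measurableType d} (p : T -> 'I_m -> R).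
Hypothesis mp : forall i, measurable_fun setT (fun w => p w i).

Let measurable_pattern_event (jk : 'I_m * 'I_m.+1) :
  measurable [set w | p w jk.1 <= q * (jk.2 : nat)%:R / m%:R].
Proof.
rewrite (_ : [set _ | _] = (fun w => p w jk.1) @^-1` `]-oo, (q * (jk.2 : nat)%:R / m%:R)]).
  by rewrite -[X in measurable X]setTI; exact: mp.
by apply/seteqP; split => w /=; rewrite in_itv.
Qed.

Lemma measurable_fun_BH_nrej (g : nat -> R) :
  measurable_fun setT (fun w => g (BH_nrej q (p w))).
Proof.
rewrite (_ : (fun w => _) = (fun w => g (pattern_nrej (rejection_pattern (p w))))).
  exact: (measurable_fun_pattern (g \o pattern_nrej) measurable_pattern_event).
by apply/funext => w; rewrite BH_nrej_pattern.
Qed.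

Lemma measurable_fun_FDP (theta : 'I_m -> R) : 0 < q ->
  measurable_fun setT (fun w => FDP q theta (p w)).
Proof.
move=> q0; pose g B : R := \sum_(i < m | theta i <= 0)
  ((i, inord (pattern_nrej B)) \in B)%:R / (maxn (pattern_nrej B) 1)%:R.
rewrite (_ : (fun w => _) = (fun w => g (rejection_pattern (p w)))).
  exact: (measurable_fun_pattern g measurable_pattern_event).
apply/funext => w; rewrite FDP_sum// /g -BH_nrej_pattern; apply: eq_bigr => i _.
by rewrite inE /= inordK// ltnS; have [] := BH_nrejP q (p w).
Qed.

End measurable_BH.

(** * FDR under independent p-values *)

Section independent_FDR.
Context {d : measure_display} {T : measurableType d} {R : realType}.
Variables (P : probability T R) (q : R) (m : nat) (f : 'I_m -> T -> R).
Hypothesis q0 : 0 < q.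
Hypothesis mf : forall i, measurable_fun setT (f i).

Definition pvals (w : m.-tuple T) (i : 'I_m) : R := f i (tnth w i).

Definition nrej_out (i : 'I_m) (w : m.-tuple T) : nat :=
  BH_nrej q (zero_at (pvals w) i).

Lemma measurable_pvals i : measurable_fun setT (fun w => pvals w i).
Proof. by apply: measurableT_comp => //; exact: measurable_tnth. Qed.

Lemma measurable_zero_at i j : measurable_fun setT (fun w => zero_at (pvals w) i j).
Proof.
by rewrite /zero_at; case: eqP => _; [exact: measurable_cst|exact: measurable_pvals].
Qed.

Lemma measurable_nrej_out i (g : nat -> R) :
  measurable_fun setT (fun w => g (nrej_out i w)).
Proof. exact: (measurable_fun_BH_nrej q (measurable_zero_at i)). Qed.

Lemma nrej_out_upd i w y : nrej_out i (tuple_upd i (w, y)) = nrej_out i w.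
Proof.
rewrite /nrej_out; congr (BH_nrej q _); apply/funext => j; rewrite /zero_at /pvals.
by rewrite tnth_mktuple; case: eqP.
Qed.

Lemma nrej_out_bounds i w : (0 < nrej_out i w <= m)%N.
Proof. by rewrite BH_nrej_zero_at_gt0//; have [] := BH_nrejP q (zero_at (pvals w) i). Qed.

Let level k : R := q * k%:R / m%:R.

Lemma measurable_pval_le i (c : R) : measurable [set y | f i y <= c].
Proof.
rewrite (_ : [set _ | _] = f i @^-1` `]-oo, c]).
  by rewrite -[X in measurable X]setTI; exact: mf.
by apply/seteqP; split => w /=; rewrite in_itv.
Qed.

(** Leave-one-out makes each summand an indicator for [f i] at a threshold free of coordinate i.
    Resampling that coordinate turns the indicator into a probability. *)
Lemma expectation_FDP (theta : 'I_m -> R) :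
  (\int[iid_prob P m]_w (FDP q theta (pvals w))%:E =
   \sum_(i < m | (theta i <= 0)%R) \int[iid_prob P m]_w
     (P [set y | (f i y <= level (nrej_out i w))%R] * ((nrej_out i w)%:R^-1)%:E))%E.
Proof.
pose g i w : R := (pvals w i <= level (nrej_out i w))%R%:R / (nrej_out i w)%:R.
have g0 i w : (0 <= (g i w)%:E)%E by rewrite lee_fin divr_ge0.
have mg i : measurable_fun setT (g i).
  (* The summand is itself an FDP, for the configuration whose only true null is i, and so inherits
     its measurability. *)
  rewrite (_ : g i = fun w => FDP q (fun j => if j == i then 0 else 1) (pvals w)).
    exact: measurable_fun_FDP measurable_pvals _ q0.
  apply/funext => w; rewrite FDP_leave_one_out// (bigD1 i) ?eqxx//= big1 ?addr0//.
  by move=> j /andP[+ ji]; rewrite (negbTE ji) ler10.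
transitivity (\int[iid_prob P m]_w (\sum_(i < m | (theta i <= 0)%R) (g i w)%:E))%E.
  by apply: eq_integral => w _; rewrite FDP_leave_one_out// sumEFin.
under eq_integral do rewrite -big_filter.
rewrite ge0_integral_sum ?big_filter//; last by move=> i; exact/measurable_EFinP.
apply: eq_bigr => i _; rewrite [LHS](resample P i); [|exact/measurable_EFinP|exact: g0].
apply: eq_integral => w _.
under eq_integral do rewrite /g nrej_out_upd /pvals tnth_mktuple eqxx EFinM.
rewrite ge0_integralZr//.
- congr (_ * _)%E.
  rewrite -[X in _ = P X]setIT -integral_indic//; last exact: measurable_pval_le.
  apply: eq_integral => y _; rewrite indicE.
  by congr ((nat_of_bool _)%:R)%:E; apply/idP/idP; rewrite inE.
- apply/measurable_EFinP.
  rewrite (_ : (fun _ => _) = \1_[set y | f i y <= level (nrej_out i w)]).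
    by apply: measurable_indic; exact: measurable_pval_le.
  apply/funext => y; rewrite indicE.
  by congr ((nat_of_bool _)%:R); apply/idP/idP; rewrite inE.
Qed.

(** At level t = q r / m the bound [C i * t], divided by r, is C_i q / m: the random number of
    rejections cancels. *)
Lemma expectation_FDP_le (theta : 'I_m -> R) (C : 'I_m -> R) :
  (forall i, theta i <= 0 -> 0 <= C i) ->
  (forall i t, theta i <= 0 -> 0 < t <= q -> (P [set y | (f i y <= t)%R] <= (C i * t)%:E)%E) ->
  (\int[iid_prob P m]_w (FDP q theta (pvals w))%:E <=
   (q / m%:R * \sum_(i < m | theta i <= 0) C i)%:E)%E.
Proof.
move=> C0 H; rewrite expectation_FDP mulr_sumr -sumEFin; apply: lee_sum => i ti.
rewrite -[leRHS]mule1 -(probability_setT (iid_prob P m)) -integral_cst//.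
apply: ge0_le_integral => //.
- by move=> w _; rewrite mule_ge0// lee_fin.
- pose g k := fine (P [set y | f i y <= level k]) * k%:R^-1.
  rewrite (_ : (fun w => _) = EFin \o (fun w => g (nrej_out i w))).
    by apply/measurable_EFinP; exact: measurable_nrej_out.
  by apply/funext => w /=; rewrite EFinM fineK// fin_num_measure//; exact: measurable_pval_le.
- move=> w _; have /andP[r0 rm] := nrej_out_bounds i w.
  have m0 : (0 < m)%N by exact: leq_trans rm.
  have l0 : 0 < level (nrej_out i w) <= q.
    rewrite /level divr_gt0 ?mulr_gt0 ?ltr0n//=.
    by rewrite ler_pdivrMr ?ltr0n// ler_pM2l// ler_nat.
  apply: le_trans (lee_wpmul2r _ (H i _ ti l0)) _; first by rewrite lee_fin.
  rewrite /= -EFinM lee_fin /level le_eqVlt; apply/orP; left; apply/eqP.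
  by field; rewrite !pnatr_eq0 -!lt0n r0 m0.
Qed.

End independent_FDR.

(** * The common-factor model: upper bound *)

Section std_normal_density.
Context {R : realType}.
Local Notation mu := (@lebesgue_measure R).
Local Notation pdf := (@normal_pdf R).

Lemma integral_std_normal (g : R -> \bar R) :
  measurable_fun setT g -> (forall x, 0 <= g x)%E ->
  (\int[std_normal]_z g z = \int[mu]_z (g z * (pdf 0 1 z)%:E))%E.
Proof.
move=> mg g0.
have dom : (@std_normal R) `<< mu by exact: normal_prob_dominates.
rewrite -(Radon_Nikodym_SigmaFinite.change_of_variables dom g0 measurableT)//.
(* The Radon-Nikodym derivative and the Gaussian density have equal integrals over every measurable
   set, hence agree almost everywhere. *)
have h : ae_eq mu setT (Radon_Nikodym_SigmaFinite.f (@std_normal R) mu) (fun z => (pdf 0 1 z)%:E).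
  apply: integral_ae_eq => //.
  - exact: Radon_Nikodym_SigmaFinite.f_integrable.
  - by apply/measurable_EFinP; exact: measurable_normal_pdf.
  - by move=> E _ mE; rewrite -Radon_Nikodym_SigmaFinite.f_integral.
have mf := measurable_int _ (Radon_Nikodym_SigmaFinite.f_integrable dom).
apply: ae_eq_integral => //.
- exact: emeasurable_funM.
- apply: emeasurable_funM => //.
  by apply/measurable_EFinP; exact: measurable_normal_pdf.
- exact: ae_eqe_mul2l.
Qed.

End std_normal_density.

Section probability_integral.
Context {d : measure_display} {T : measurableType d} {R : realType}.

Lemma integral_prob_le (P : probability T R) (f : T -> \bar R) (c : R) :
  measurable_fun setT f -> (forall x, 0 <= f x)%E -> (forall x, f x <= c%:E)%E ->
  (\int[P]_x f x <= c%:E)%E.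
Proof.
move=> mf f0 fc; rewrite -[leRHS]mule1 -(probability_setT P) -integral_cst//.
exact: ge0_le_integral.
Qed.

End probability_integral.

Section common_factor.
Context {R : realType}.
Variables (q : R) (m : nat) (theta a : 'I_m -> R).
Hypothesis q0 : 0 < q.

Definition factor_pval (z : R) (i : 'I_m) (y : R) : R :=
  Phibar (theta i + a i * z + Num.sqrt (1 - a i ^+ 2) * y).

Lemma measurable_Phibar : measurable_fun setT (@Phibar R).
Proof. exact: continuous_measurable_fun continuous_Phibar. Qed.

Lemma measurable_factor_pval z i : measurable_fun setT (factor_pval z i).
Proof.
apply: (measurableT_comp measurable_Phibar).
by apply: measurable_funD => //; exact: measurable_funM.
Qed.

Lemma measurable_cf_pval i :
  measurable_fun setT (fun w : R * m.-tuple R => cf_pval theta a w i).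
Proof.
apply: (measurableT_comp measurable_Phibar).
apply: measurable_funD; first by apply: measurable_funD => //; exact: measurable_funM.
apply: measurable_funM => //; apply: (measurableT_comp (measurable_tnth i)).
exact: measurable_snd.
Qed.

Definition cond_FDR (z : R) : \bar R :=
  (\int[iid_prob std_normal m]_w
     (FDP q theta (pvals (factor_pval z) w))%:E)%E.

Lemma measurable_FDP_joint : measurable_fun setT (fun w : R * m.-tuple R =>
  (FDP q theta (cf_pval theta a w))%:E).
Proof. by apply/measurable_EFinP; apply: measurable_fun_FDP q0; exact: measurable_cf_pval. Qed.

Lemma measurable_cond_FDR : measurable_fun setT cond_FDR.
Proof.
have h := @measurable_fun_fubini_tonelli_F _ _ _ _ _ (iid_prob (@std_normal R) m) _
  measurable_FDP_joint.
by apply: h => w; rewrite lee_fin FDP_ge0.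
Qed.

Lemma cond_FDR_ge0 z : (0 <= cond_FDR z)%E.
Proof. by apply: integral_ge0 => w _; rewrite lee_fin FDP_ge0. Qed.

Lemma cond_FDR_le1 z : (cond_FDR z <= 1)%E.
Proof.
apply: integral_prob_le.
- apply/measurable_EFinP; apply: measurable_fun_FDP q0 => i.
  apply: (@measurable_pvals _ (measurableTypeR R) R m (factor_pval z)) => j.
  exact: measurable_factor_pval.
- by move=> w; rewrite lee_fin FDP_ge0.
- by move=> w; rewrite lee_fin FDP_le1.
Qed.

(** Tonelli over the factor; the integral lies in [0, 1], so [fine] loses nothing. *)
Lemma FDR_cond : (FDR q theta a)%:E = (\int[std_normal]_z cond_FDR z)%E.
Proof.
have e : ('E_(cf_law m)[fun w => FDP q theta (cf_pval theta a w)])%E =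
    (\int[std_normal]_z cond_FDR z)%E.
  rewrite unlock /cf_law fubini_tonelli1//; first exact: measurable_FDP_joint.
  by move=> w; rewrite lee_fin FDP_ge0.
rewrite /FDR e fineK//; apply/fin_numPlt; apply/andP; split.
  by rewrite (lt_le_trans _ (integral_ge0 _ _))// ?ltNy0// => z _; exact: cond_FDR_ge0.
apply: le_lt_trans (ltry 1).
apply: integral_prob_le.
- exact: measurable_cond_FDR.
- exact: cond_FDR_ge0.
- exact: cond_FDR_le1.
Qed.


Lemma std_normal_pval_le (b s x : R) : 0 < s ->
  std_normal [set y : R | (Phibar (b + s * y) <= Phibar x)%R]
    = (Phibar ((x - b) / s))%:E.
Proof.
move=> s0; rewrite -std_normal_tail; congr (std_normal _).
apply/seteqP; split => y /=; rewrite Phibar_leP in_itv/= andbT.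
  by move=> h; rewrite ler_pdivrMr// lerBlDl mulrC.
by rewrite ler_pdivrMr// lerBlDl mulrC.
Qed.

End common_factor.

Section upper_bound.
Context {R : realType}.
Local Notation mu := (@lebesgue_measure R).
Local Notation pdf := (@normal_pdf R).
Local Notation peak := (Num.sqrt ((pi : R) *+ 2))^-1.
Implicit Types (a s x z u : R).

(** For |z| < x outside this interval, all centres a u with u >= x lie on the same side of z and a x
    is the nearest of them. Inside it some a u may coincide with z, and only the peak bounds the
    density. *)
Definition gap a x : set R :=
  [set` if 0 <= a then `[(a * x), x] else `[(- x), (a * x)]].

(* Dominates [pdf 0 1 z] times the likelihood ratio of [N(a z, s^2)] against
   [N(0, 1)] above the level [x]. *)
Definition tilt_bound a s x z : R := pdf (a * x) s z + peak / s * \1_(gap a x) z.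

Lemma tilt_bound_ge0 a s x z : 0 < s -> 0 <= tilt_bound a s x z.
Proof.
move=> s0; rewrite addr_ge0 ?normal_pdf_ge0// mulr_ge0//.
by rewrite divr_ge0 ?invr_ge0 ?sqrtr_ge0// ltW.
Qed.

Lemma measurable_gap a x : measurable (gap a x).
Proof. by rewrite /gap; case: ifP. Qed.

Lemma measurable_tilt_bound a s x : measurable_fun setT (tilt_bound a s x).
Proof.
apply: measurable_funD; first exact: measurable_normal_pdf.
by apply: measurable_funM => //; apply: measurable_indic; exact: measurable_gap.
Qed.

Lemma pdf_le_center b c s z : 0 < s -> `|z - c| <= `|z - b| -> pdf b s z <= pdf c s z.
Proof.
move=> s0 h; rewrite !normal_pdfE ?gt_eqF// ler_wpM2l ?normal_peak_ge0// ler_expR.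
rewrite ler_wpM2r ?invr_ge0 ?mulrn_wge0 ?sqr_ge0// lerN2.
by rewrite -(real_normK (num_real (z - c))) -(real_normK (num_real (z - b))) lerXn2r ?nnegrE.
Qed.

Lemma pdf_le_tilt_bound a s x z u : 0 < s -> 0 <= x -> `|z| < x -> x <= u ->
  pdf (a * u) s z <= tilt_bound a s x z.
Proof.
move=> s0 x0 zx xu; rewrite /tilt_bound.
have K0 : 0 <= peak / s by rewrite divr_ge0 ?invr_ge0 ?sqrtr_ge0// ltW.
have [zgap|zgap] := boolP (z \in gap a x).
  rewrite indicE zgap mulr1 (le_trans (pdf_le_peak _ _ s0))//.
  by rewrite lerDr normal_pdf_ge0.
rewrite indicE (negbTE zgap) mulr0 addr0; apply: pdf_le_center => //.
move: zx; rewrite ltr_norml => /andP[xz zx].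
move: zgap; rewrite /gap; case: ifP => a0; rewrite notin_setE/= in_itv/= => /negP.
  rewrite (ltW zx) andbT -ltNge => zax.
  have axu : a * x <= a * u by rewrite ler_wpM2l.
  rewrite !ler0_norm; lra.
rewrite (ltW xz)/= -ltNge => zax; move/negbT: a0; rewrite -ltNge => a0.
have axu : a * u <= a * x by rewrite ler_wnM2l// ltW.
rewrite !ger0_norm; lra.
Qed.

(** [joint_pdf_sym] rewrites phi(z) times the likelihood ratio at v as the density of N(a v, s^2) at
    z, which [pdf_le_tilt_bound] controls uniformly in v >= x. *)
Lemma Phibar_le_tilt_bound a s x z u : 0 < s -> a ^+ 2 + s ^+ 2 = 1 ->
  0 <= x -> `|z| < x -> x <= u ->
  Phibar ((u - a * z) / s) <= tilt_bound a s x z / pdf 0 1 z * Phibar u.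
Proof.
move=> s0 as1 x0 zx xu; apply: tail_comparison => //.
  by rewrite divr_ge0 ?tilt_bound_ge0// normal_pdf_ge0.
move=> v uv; rewrite -(ler_pM2l (pdf1_gt0 z)) joint_pdf_sym//.
rewrite [leRHS](_ : _ = pdf 0 1 v * tilt_bound a s x z); last first.
  by field; rewrite gt_eqF// pdf1_gt0.
rewrite ler_wpM2l ?normal_pdf_ge0// pdf_le_tilt_bound//.
exact: le_trans uv.
Qed.

(** The density contributes 1. The gap has length (1 - |a|) x, and (1 - |a|)^2 <= 1 - a^2 = s^2
    absorbs the factor 1 / s of the peak. *)
Lemma integral_tilt_bound a s x : 0 < s -> a ^+ 2 + s ^+ 2 = 1 -> 0 <= x ->
  (\int[mu]_z (tilt_bound a s x z)%:E <= (1 + peak * x)%:E)%E.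
Proof.
move=> s0 as1 x0; have K0 : 0 <= peak / s by rewrite divr_ge0 ?invr_ge0 ?sqrtr_ge0// ltW.
under eq_integral do rewrite EFinD.
rewrite ge0_integralD//; last 4 first.
- by move=> z _; rewrite lee_fin normal_pdf_ge0.
- by apply/measurable_EFinP; exact: measurable_normal_pdf.
- by move=> z _; rewrite lee_fin mulr_ge0.
- by apply/measurable_EFinP/measurable_funM => //; apply: measurable_indic; exact: measurable_gap.
rewrite integral_normal_pdf EFinD leeD2l//.
under eq_integral do rewrite EFinM.
rewrite ge0_integralZl_EFin//; last first.
  by apply/measurable_EFinP/measurable_indic; exact: measurable_gap.
rewrite integral_indic//; last exact: measurable_gap.
rewrite setIT.
have a1 : `|a| <= 1.
  rewrite -(@expr_le1 _ 2)// real_normK ?num_real//.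
  by have := sqr_ge0 s; lra.
rewrite [X in (_ * X)%E](_ : _ = ((1 - `|a|) * x)%:E); last first.
  transitivity (mu (gap a x)) => //.
  rewrite /gap; case: ifP => a0; rewrite lebesgue_measure_itv/= lte_fin.
    rewrite ger0_norm//; move: a1; rewrite ger0_norm// => a1.
    by case: ltP => h; rewrite -?EFinB; congr EFin; nra.
  move/negbT: a0; rewrite -ltNge => a0; rewrite ltr0_norm//; move: a1; rewrite ltr0_norm// => a1.
  by case: ltP => h; rewrite -?EFinB; congr EFin; nra.
rewrite -EFinM lee_fin mulrA ler_wpM2r// -mulrA ler_piMr ?invr_ge0 ?sqrtr_ge0//.
rewrite mulrC ler_pdivrMr// mul1r -ler_sqr ?nnegrE ?subr_ge0 ?(ltW s0)//.
have -> : s ^+ 2 = 1 - `|a| ^+ 2 by rewrite real_normK ?num_real//; lra.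
by have := normr_ge0 a; nra.
Qed.

Lemma cond_FDR_le q m (theta a : 'I_m -> R) x z (K : 'I_m -> R) :
  0 < q -> Phibar x = q -> 0 <= x -> `|z| < x -> (forall i, -1 <= a i <= 1) ->
  (forall i, 0 <= K i) ->
  (forall i, let s := Num.sqrt (1 - a i ^+ 2) in 0 < s ->
     K i = tilt_bound (a i) s x z / pdf 0 1 z) ->
  (cond_FDR q theta a z <= (q / m%:R * \sum_(i < m | (theta i <= 0)%R) K i)%:E)%E.
Proof.
move=> q0 xq x0 zx a1 K0 KE; apply: expectation_FDP_le => //.
  exact: measurable_factor_pval.
move=> i t ti /andP[t0 tq].
have tq2 : 0 < t <= 2^-1.
  by rewrite t0 (le_trans tq)// -xq -(@Phibar0 R) Phibar_le.
have [u u0 ut] := Phibar_quantile tq2.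
have xu : x <= u by rewrite -Phibar_leP ut xq.
have a2 : 0 <= 1 - a i ^+ 2 by have := a1 i; nra.
rewrite /factor_pval; set s := Num.sqrt _.
(* Without individual noise a null statistic is at most a_i z <= |z| < x <= u, so its p-value
   exceeds t and the event is empty. *)
have [s0|s0] := eqVneq s 0.
  rewrite (_ : [set _ | _] = set0) ?measure0 ?lee_fin ?mulr_ge0 ?(ltW t0)//.
  apply/seteqP; split => y //=; rewrite s0 mul0r addr0 -ut Phibar_leP => h.
  have ai : `|a i| <= 1 by rewrite ler_norml.
  have : a i * z <= `|z|.
    by rewrite (le_trans (ler_norm _))// normrM ler_piMl.
  by lra.
have {}s0 : 0 < s by rewrite lt_neqAle eq_sym s0 sqrtr_ge0.
have as1 : a i ^+ 2 + s ^+ 2 = 1 by rewrite sqr_sqrtr//; ring.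
rewrite -ut std_normal_pval_le// lee_fin KE//.
apply: le_trans (Phibar_le_tilt_bound s0 as1 x0 zx xu).
(* A parameter theta_i <= 0 only lowers the statistic; theta_i = 0 is the worst case. *)
apply: Phibar_le; rewrite ler_pM2r ?invr_gt0//; lra.
Qed.

Lemma FDR_le q m (theta a : 'I_m -> R) x :
  0 < q -> (0 < m)%N -> Phibar x = q -> 0 <= x -> (forall i, -1 <= a i <= 1) ->
  FDR q theta a <= q * (3 + peak * x).
Proof.
move=> q0 m0 xq x0 a1; rewrite -lee_fin FDR_cond//.
pose s i : R := Num.sqrt (1 - a i ^+ 2).
have as1 i : a i ^+ 2 + s i ^+ 2 = 1.
  by rewrite sqr_sqrtr; [ring|have := a1 i; nra].
pose K i z : R := if s i == 0 then 0 else tilt_bound (a i) (s i) x z / pdf 0 1 z.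
have spos i : s i != 0 -> 0 < s i by rewrite lt_neqAle eq_sym sqrtr_ge0 andbT.
have K0 i z : 0 <= K i z.
  by rewrite /K; case: eqVneq => // /spos si; rewrite divr_ge0 ?tilt_bound_ge0 ?normal_pdf_ge0.
have mK i : measurable_fun setT (K i).
  rewrite /K; case: eqVneq => _; first exact: measurable_cst.
  apply: measurable_funM; first exact: measurable_tilt_bound.
  apply: continuous_measurable_fun => z; apply: cvgV; first by rewrite gt_eqF// pdf1_gt0.
  exact: continuous_normal_pdf.
pose A : set R := [set z : R | x <= `|z|].
have mA : measurable A.
  rewrite /A (_ : [set _ | _] = (fun z : R => `|z|) @^-1` `[x, +oo[).
    by rewrite -[X in measurable X]setTI; exact: normr_measurable.
  by apply/seteqP; split => z /=; rewrite in_itv/= andbT.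
have qm : 0 <= q / m%:R by rewrite divr_ge0// ltW.
(* The dominating function: 1 on |z| >= x, costing 2 q, plus the conditional bound summed over all
   i, costing q (1 + peak x). *)
pose g z : \bar R := ((\1_A z)%:E + \sum_(i < m) (q / m%:R * K i z)%:E)%E.
have sum0 z : (0 <= \sum_(i < m) (q / m%:R * K i z)%:E)%E.
  by apply: sume_ge0 => i _; rewrite lee_fin mulr_ge0.
have g0 z : (0 <= g z)%E by rewrite adde_ge0// lee_fin.
have mg1 : measurable_fun setT (fun z => (\1_A z : R)%:E).
  by apply/measurable_EFinP/measurable_indic.
have mg2 i : measurable_fun setT (fun z => (q / m%:R * K i z)%:E).
  by apply/measurable_EFinP/measurable_funM.
have mg : measurable_fun setT g.
  by apply: emeasurable_funD => //; apply: emeasurable_sum.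
apply: (@le_trans _ _ (\int[std_normal]_z g z)%E).
  apply: ge0_le_integral => //.
  - by move=> z _; exact: cond_FDR_ge0.
  - exact: measurable_cond_FDR.
  move=> z _; have [zx|xz] := ltP `|z| x; last first.
    apply: le_trans (cond_FDR_le1 _ _ _ _) _ => //.
    by rewrite /g indicE mem_set//= leeDl.
  apply: le_trans (@cond_FDR_le q m theta a x z (K^~ z) q0 xq x0 zx a1 _ _) _ => //.
    by move=> i /= si; rewrite /K -/(s i) gt_eqF.
  rewrite /g mulr_sumr -sumEFin (@le_trans _ _ (\sum_(i < m) (q / m%:R * K i z)%:E)%E)//.
    rewrite big_mkcond/=; apply: lee_sum => i _; case: ifP => // _.
    by rewrite lee_fin mulr_ge0.
  by rewrite leeDr// lee_fin.
rewrite ge0_integralD//; last by apply: emeasurable_sum.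
rewrite ge0_integral_sum//; last by move=> i z _; rewrite lee_fin mulr_ge0.
rewrite integral_indic// setIT.
have two : (std_normal A <= (2 * q)%:E)%E.
  by apply: le_trans (std_normal_two_tails _) _; rewrite xq.
have tot i : (\int[std_normal]_z (q / m%:R * K i z)%:E <= (q / m%:R * (1 + peak * x))%:E)%E.
  under eq_integral do rewrite EFinM.
  rewrite ge0_integralZl_EFin//; last 2 first.
  - by move=> z _; rewrite lee_fin.
  - by apply/measurable_EFinP; exact: mK.
  rewrite [in leRHS]EFinM; apply: lee_wpmul2l; first by rewrite lee_fin.
  rewrite integral_std_normal; [|exact/measurable_EFinP|by move=> z; rewrite lee_fin].
  rewrite /K; case: eqVneq => [_|/spos si].
    under eq_integral do rewrite mul0e.
    rewrite integral0 lee_fin addr_ge0// mulr_ge0// invr_ge0 sqrtr_ge0//.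
  apply: le_trans (integral_tilt_bound si (as1 i) x0).
  rewrite le_eqVlt; apply/orP; left; apply/eqP; apply: eq_integral => z _.
  by rewrite -EFinM divfK// gt_eqF// pdf1_gt0.
apply: (@le_trans _ _ ((2 * q)%:E + \sum_(i < m) (q / m%:R * (1 + peak * x))%:E)%E).
  by apply: leeD => //; apply: lee_sum.
rewrite sumEFin sumr_const card_ord -EFinD lee_fin -[X in _ + X <= _]mulr_natl.
rewrite mulrA (mulrCA m%:R) divff ?mulr1; last by rewrite pnatr_eq0 -lt0n.
by lra.
Qed.

End upper_bound.

(** * Lower bound *)

Lemma card_ord_ltn n k : (k <= n)%N -> #|[pred j : 'I_n | (j < k)%N]| = k.
Proof.
move=> kn; rewrite -sum1_card (eq_bigl (fun j : 'I_n => (j < k)%N)); last by [].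
by rewrite -(big_ord_widen n (fun=> 1%N) kn) sum_nat_const card_ord muln1.
Qed.

Lemma card_ord_le (R : realType) n (A : {pred 'I_n}) (v : R) : 0 <= v ->
  (forall j, j \in A -> j.+1%:R <= v) -> #|A|%:R <= v.
Proof.
move=> v0 h; have kv : (Num.truncn v)%:R <= v by rewrite truncn_le.
apply: le_trans kv; rewrite ler_nat.
apply: leq_trans (geq_minr n _); rewrite -[leqRHS](@card_ord_ltn n) ?geq_minl//.
apply: subset_leq_card; apply/fintype.subsetP => j /h jv.
by rewrite inE leq_min ltn_ord truncn_gt_nat.
Qed.

(** Used when the threshold u falls short of z / a by at least h / a: a false null with parameter (1
    + a) x that is still rejected must have its quantile x beyond u by h / 2. *)
Lemma crossing_shift (R : realFieldType) (a h u x z : R) : 0 < a -> a <= 2^-1 -> 0 < h ->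
  a * u <= z - h -> u <= (1 + a) * x - z -> u + h / 2 <= x.
Proof.
move=> a0 a2 h0 auz ux.
have ah : a * h <= 2^-1 * h by rewrite ler_pM2r.
have a10 : 0 < 1 + a by rewrite addr_gt0.
rewrite -(ler_pM2l a10).
have -> : (1 + a) * (u + h / 2) = u + a * u + h / 2 + a * h / 2 by field.
move: auz ah ux; move: (a * u) (a * h) (_ * x) => au ah ax.
lra.
Qed.

Section lower_bound.
Context {R : realType}.
Local Notation mu := (@lebesgue_measure R).
Local Notation pdf := (@normal_pdf R).
Local Notation peak := (Num.sqrt ((pi : R) *+ 2))^-1.

(* [1 / b] is the proportion of false nulls, and [h] the tolerance on [z - a u]
   for the BH threshold [u] at [z]. *)
Variables (q h a X zmax : R) (b m1 : nat) (xi : R -> R).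
Hypothesis q0 : 0 < q.
Hypothesis q2 : q <= 2^-1.
Hypothesis b1 : (1 < b)%N.
Hypothesis m10 : (0 < m1)%N.
Hypothesis a0 : 0 < a.
Hypothesis a2 : a <= 2^-1.
Hypothesis h0 : 0 < h.
Hypothesis h1 : h <= 1.
Hypothesis xiP : forall t, 0 < t <= 2^-1 -> Phibar (xi t) = t.
Hypothesis PX : Phibar X = q / b%:R.
(** As q / b is the BH level for m1 rejections, this puts every target z / a with z >= 1 beyond X:
    at most m1 rejections are aimed at. *)
Hypothesis aX : a * X <= 1.
Hypothesis slack : forall u, Phibar u < 4 * q / b%:R ->
  Phibar (u + h / 2) <= Phibar u / 4.

Let m := (b * m1)%N.
(** Even at the most remote target zmax / a, the level corresponds to at least 4 rejections. *)
Hypothesis mZ : 4 <= m%:R / q * Phibar (zmax / a).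

Let s := Num.sqrt (1 - a ^+ 2).

(* The false nulls [i < m1] are driven by minus the common factor alone: when it
   equals [z], those exceeding the level [z / a] are exactly the ones with
   [xi_i >= z / a], where [xi_i] is the BH threshold for [i + 1] rejections. *)
Let theta (i : 'I_m) : R :=
  if (i < m1)%N then (1 + a) * xi (q * i.+1%:R / m%:R) else 0.
Let coef (i : 'I_m) : R := if (i < m1)%N then - 1 else a.

Let m0 : (0 < m)%N.
Proof. by rewrite muln_gt0 m10 (ltn_trans _ b1). Qed.

Let mR0 : 0 < m%:R :> R. Proof. by rewrite ltr0n. Qed.

Let bR0 : b%:R != 0 :> R.
Proof. by rewrite pnatr_eq0 -lt0n (ltn_trans _ b1). Qed.

Let m1m : (m1 < m)%N.
Proof. by rewrite -[ltnLHS]mul1n ltn_pmul2r. Qed.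

Let aa : a ^+ 2 <= 4^-1.
Proof.
rewrite (_ : 4^-1 = 2^-1 * 2^-1 :> R); last by field.
by rewrite expr2 ler_pM// ltW.
Qed.

Let as1 : a ^+ 2 + s ^+ 2 = 1.
Proof. by rewrite sqr_sqrtr; [ring|have := aa; lra]. Qed.

Let s2 : 2^-1 <= s.
Proof.
rewrite -(@ler_sqr _ 2^-1 s) ?nnegrE ?sqrtr_ge0//.
by have := as1; have := aa; rewrite [2^-1 ^+ 2]expr2; lra.
Qed.

Let s0 : 0 < s. Proof. by apply: lt_le_trans s2; rewrite invr_gt0. Qed.

Let level_itv k : (0 < k <= m)%N -> 0 < q * k%:R / m%:R <= q.
Proof.
move=> /andP[k0 km]; rewrite divr_gt0 ?mulr_gt0 ?ltr0n//=.
by rewrite ler_pdivrMr// ler_pM2l// ler_nat.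
Qed.

Let xi_level k : (0 < k <= m)%N -> Phibar (xi (q * k%:R / m%:R)) = q * k%:R / m%:R.
Proof.
by move=> /level_itv/andP[l0 lq]; rewrite xiP// l0 (le_trans lq).
Qed.

(** * The construction at a fixed value of the common factor *)

Section fixed_factor.
Variable z : R.
Hypothesis z1 : 1 <= z.
Hypothesis zZ : z <= zmax.

Let f := factor_pval theta coef z.

Let f_false (i : 'I_m) (y : R) : (i < m1)%N ->
  f i y = Phibar ((1 + a) * xi (q * i.+1%:R / m%:R) - z).
Proof.
move=> im; rewrite /f /factor_pval /theta /coef im sqrrN expr1n subrr sqrtr0 mul0r.
by rewrite mulN1r addr0.
Qed.

Let f_null (i : 'I_m) (y : R) : ~~ (i < m1)%N -> f i y = Phibar (a * z + s * y).
Proof. by move=> /negbTE im; rewrite /f /factor_pval /theta /coef im add0r. Qed.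

Let mf i : measurable_fun setT (f i).
Proof. exact: measurable_factor_pval. Qed.

(** Let v = m [Phibar (z / a)] / q and k its integer part. The first k false nulls have quantiles
    x_j >= z / a, so (1 + a) x_j - z >= x_j and their p-values are at most q (j + 1) / m. With the
    zeroed coordinate i, k + 1 > v rejections are feasible. *)
Lemma nrej_out_lower (i : 'I_m) w : ~~ (i < m1)%N ->
  Phibar (z / a) < q * (nrej_out q f i w)%:R / m%:R.
Proof.
move=> im; set v := m%:R / q * Phibar (z / a).
have v0 : 0 <= v by rewrite mulr_ge0 ?Phibar_ge0// divr_ge0// ltW.
have /andP[kv vk] := truncn_itv v0; set k := Num.truncn v in kv vk.
have vE : Phibar (z / a) = q * v / m%:R by rewrite /v; field; rewrite !gt_eqF.
have Xz : X <= z / a by rewrite ler_pdivlMr// mulrC (le_trans aX).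
have km1 : (k <= m1)%N.
  rewrite -(ler_nat R) (le_trans kv)//.
  apply: (@le_trans _ _ (m%:R / q * (q / b%:R))).
    by rewrite ler_wpM2l ?divr_ge0 ?(ltW q0)// -PX Phibar_le.
  rewrite /m natrM le_eqVlt; apply/orP; left; apply/eqP; field.
  by rewrite bR0 gt_eqF.
have km : (k < m)%N by exact: leq_ltn_trans m1m.
suff kr : (k < nrej_out q f i w)%N.
  rewrite vE ltr_pM2r ?invr_gt0// ltr_pM2l// (lt_le_trans vk)// ler_nat//.
apply: BH_nrej_ge => //; rewrite /npval_le.
have cE : #|[predU1 i & [pred j : 'I_m | (j < k)%N]]| = k.+1.
  rewrite cardU1 card_ord_ltn ?(ltnW km)// inE -leqNgt.
  by rewrite (leq_trans km1) ?add1n// leqNgt.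
rewrite -[leqLHS]cE; apply: subset_leq_card; apply/fintype.subsetP => j; rewrite !inE /zero_at.
case: eqP => [_ _|_ /= jk]; first by rewrite divr_ge0// mulr_ge0// ltW.
have jm1 : (j < m1)%N by exact: leq_trans km1.
rewrite /pvals f_false//; set x := xi _.
have xE : Phibar x = q * j.+1%:R / m%:R by rewrite /x xi_level// ltn_ord.
have zx : z / a <= x.
  rewrite -Phibar_leP xE vE ler_pM2r ?invr_gt0// ler_pM2l//.
  by rewrite (le_trans _ kv)// ler_nat.
apply: (@le_trans _ _ (Phibar x)).
  apply: Phibar_le; move: zx; rewrite ler_pdivrMr//; lra.
rewrite xE ler_pM2r ?invr_gt0// ler_pM2l// ler_nat; exact: leqW.
Qed.


Section overshoot_event.
Variable i : 'I_m.
Hypothesis im : ~~ (i < m1)%N.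

(* Turning the i-th hypothesis into a false null with p-value 0 makes
   [nrej_out i] the number of rejections of a BH procedure to which
   [expectation_FDP_le] applies. *)
Let f' (j : 'I_m) : R -> R := if j == i then cst 0 else f j.
Let theta' (j : 'I_m) : R := ((j == i) || (j < m1)%N)%:R.

Let mf' j : measurable_fun setT (f' j).
Proof. by rewrite /f'; case: eqP => _. Qed.

Let pvals_f' w : pvals f' w = zero_at (pvals f w) i.
Proof. by apply/funext => j; rewrite /pvals /f' /zero_at; case: eqP. Qed.

Let theta'_le0 j : (theta' j <= 0) = (j != i) && ~~ (j < m1)%N.
Proof. by rewrite /theta' -negb_or; case: (_ || _); rewrite ?lexx ?ler10. Qed.

(* The BH threshold exceeds the level aimed at by more than [h / a]. *)
Definition overshoot (w : m.-tuple R) : bool :=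
  Phibar ((z - h) / a) < q * (nrej_out q f i w)%:R / m%:R.

(** On overshoot, the threshold quantile u is below (z - h) / a. By [crossing_shift] a rejected
    false null has quantile at least u + h / 2, so [slack] puts its level under a quarter of the
    threshold and its rank under r / 4. *)
Let few_false_nulls w : overshoot w ->
  #|[pred j : 'I_m | (j < m1)%N && (pvals f w j <= q * (nrej_out q f i w)%:R / m%:R)]|%:R
    <= (nrej_out q f i w)%:R / 4 :> R.
Proof.
rewrite /overshoot; set r := nrej_out q f i w => br.
have r0 : 0 <= r%:R / 4 :> R by rewrite divr_ge0.
apply: card_ord_le => // j; rewrite inE => /andP[jm1 pj].
(* If r >= 4 m1, even all the false nulls together are at most r / 4. Otherwise the threshold is
   below 4 q / b, where [slack] applies. *)
have [rm|rm] := leP (4 * m1%:R) (r%:R : R).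
  by apply: (@le_trans _ _ m1%:R); [rewrite ler_nat|lra].
have rb : (0 < r <= m)%N by exact: nrej_out_bounds.
pose t := q * r%:R / m%:R; have tE : Phibar (xi t) = t by exact: xi_level.
set u := xi t in tE.
have tb : Phibar u < 4 * q / b%:R.
  rewrite tE /t ltr_pdivrMr//.
  apply: (@lt_le_trans _ _ (q * (4 * m1%:R))); first by rewrite ltr_pM2l.
  rewrite /m natrM le_eqVlt; apply/orP; left; apply/eqP; field; exact: bR0.
have uz : u < (z - h) / a.
  by rewrite ltNge -Phibar_leP -ltNge tE.
move: pj; rewrite /pvals f_false//; pose x := xi (q * j.+1%:R / m%:R); rewrite -/x.
have xE : Phibar x = q * j.+1%:R / m%:R by rewrite /x xi_level// ltn_ord.
rewrite -/t -tE Phibar_leP => ux.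
have auz : a * u <= z - h by rewrite mulrC -ler_pdivlMr// ltW.
have : u + h / 2 <= x by exact: (crossing_shift a0 a2 h0 auz ux).
rewrite -Phibar_leP xE => /le_trans/(_ (slack tb)); rewrite tE /t.
rewrite -mulrA (_ : q * (r%:R : R) / m%:R / 4 = q * (r%:R / 4 / m%:R)); last first.
  by field; rewrite gt_eqF.
by rewrite ler_pM2l// ler_pM2r ?invr_gt0.
Qed.

(** False nulls account for at most r / 4 rejections and i itself for 1 <= r / 4, by [mZ]. At least
    half of the rejections remain for the true nulls. *)
Let overshoot_FDP w : overshoot w -> 2^-1 <= FDP q theta' (pvals f' w).
Proof.
move=> bw; have F := few_false_nulls bw; move: bw; rewrite /overshoot => br.
rewrite FDP_sum// pvals_f' -/(nrej_out q f i w).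
set r := nrej_out q f i w in F br *.
have rb : (0 < r <= m)%N by exact: nrej_out_bounds.
have /andP[r0 rm] := rb.
rewrite (maxn_idPl r0) -mulr_suml ler_pdivlMr ?ltr0n// mulrC.
have r4 : 4 <= r%:R :> R.
  have : Phibar (zmax / a) <= Phibar ((z - h) / a).
    by apply: Phibar_le; rewrite ler_pM2r ?invr_gt0//; have := h0; have := zZ; lra.
  move=> /le_lt_trans/(_ br); rewrite ltr_pdivlMr// => h4.
  rewrite (le_trans mZ)// mulrAC ler_pdivrMr// mulrC (mulrC _ q).
  by rewrite ltW.
set c := q * r%:R / m%:R in F *.
have rE : r = npval_le (zero_at (pvals f w) i) c by rewrite /c npval_le_nrej.
set N := \sum_(_ < _ | _) _.
suff : r%:R <= 1 + #|[pred j : 'I_m | (j < m1)%N && (pvals f w j <= c)]|%:R + N by lra.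
rewrite [in leLHS]rE /npval_le -!sum1_card !natr_sum /N.
rewrite [leRHS](_ : _ = \sum_(j < m) ((j == i)%:R
   + ((j < m1)%N && (pvals f w j <= c))%:R
   + if theta' j <= 0 then (zero_at (pvals f w) i j <= c)%R%:R else 0)).
  rewrite big_mkcond/=; apply: ler_sum => j _; rewrite theta'_le0 inE.
  rewrite /zero_at; case: eqVneq => [ji|ji]/=.
    by rewrite (le_trans _ (_ : 1 <= _))//; [case: ifP|rewrite -addrA lerDl addr_ge0].
  case: (j < m1)%N => /=; case: (pvals f w j <= c); rewrite ?add0r ?addr0 ?lexx//.
rewrite !big_split/=; congr (_ + _ + _); last by rewrite big_mkcond.
  by rewrite (bigD1 i)//= eqxx big1 ?addr0// => j /negbTE ->.
by rewrite big_mkcond/=; apply: eq_bigr => j _; rewrite inE; case: ifP.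
Qed.

Let L : R := expR (z ^+ 2 / 2) / s.

Let L0 : 0 <= L. Proof. by rewrite divr_ge0 ?expR_ge0// ltW. Qed.

Let pval_null_le (j : 'I_m) t : ~~ (j < m1)%N -> 0 < t <= q ->
  (std_normal [set y : R | (f j y <= t)%R] <= (L * t)%:E)%E.
Proof.
move=> jm /andP[t0 tq].
have tE : Phibar (xi t) = t by apply: xiP; rewrite t0 (le_trans tq).
rewrite (_ : [set _ | _] = [set y | Phibar (a * z + s * y) <= Phibar (xi t)]).
  by rewrite std_normal_pval_le// lee_fin -[in leRHS]tE; exact: Phibar_tilt_le.
by apply/funext => y /=; rewrite f_null// tE.
Qed.

Let measurable_overshoot : measurable [set w | overshoot w].
Proof.
pose g (r : nat) : R := (Phibar ((z - h) / a) < q * r%:R / m%:R)%R%:R.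
rewrite (_ : [set w | _] = (fun w => g (nrej_out q f i w)) @^-1` [set 1]).
  by rewrite -[X in measurable X]setTI; exact: (measurable_nrej_out q mf i g).
apply/seteqP; split => w /=; rewrite /g -/(overshoot w); first by move=> ->.
by case: (overshoot w) => // /eqP; rewrite eq_sym oner_eq0.
Qed.

(** Markov's inequality: the modified FDP is at least 1/2 on overshoot, while its mean is at most q
    L by the likelihood-ratio bound [Phibar_tilt_le]. *)
Lemma prob_overshoot : (iid_prob std_normal m [set w | overshoot w] <= (2 * (q * L))%:E)%E.
Proof.
have up : (\int[iid_prob std_normal m]_w (FDP q theta' (pvals f' w))%:E <= (q * L)%:E)%E.
  apply: le_trans (@expectation_FDP_le _ (measurableTypeR R) R std_normal q m f' q0
    mf' theta' (fun=> L) _ _) _.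
  - by [].
  - move=> j t; rewrite theta'_le0 => /andP[ji jm] tq.
    by rewrite /f' (negbTE ji); exact: pval_null_le.
  - rewrite lee_fin mulrAC ler_pdivrMr// -mulrA ler_pM2l//.
    rewrite big_mkcond/=; apply: (@le_trans _ _ (\sum_(j < m) L)).
      by apply: ler_sum => j _; case: ifP.
    by rewrite sumr_const card_ord -[X in X <= _]mulr_natr.
have lo : ((2^-1)%:E * iid_prob std_normal m [set w | overshoot w] <=
    \int[iid_prob std_normal m]_w (FDP q theta' (pvals f' w))%:E)%E.
  rewrite -[X in iid_prob _ _ X]setIT -integral_indic// -ge0_integralZl_EFin//; last first.
  - exact/measurable_EFinP/measurable_indic.
  apply: ge0_le_integral => //.
  - by apply/measurable_EFinP/measurable_funM => //; exact: measurable_indic.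
  - apply/measurable_EFinP; apply: measurable_fun_FDP q0 => j.
    exact: (@measurable_pvals _ (measurableTypeR R) R m f' mf').
  - move=> w _; rewrite -EFinM lee_fin indicE; have [bw|bw] := boolP (overshoot w).
      by rewrite mem_set// mulr1; exact: overshoot_FDP.
    by rewrite memNset ?mulr0 ?FDP_ge0//; exact/negP.
have := le_trans lo up.
rewrite -[X in (_ * X)%E]fineK ?fin_num_measure// -EFinM lee_fin => h3.
by rewrite -[leLHS]fineK ?fin_num_measure// lee_fin; lra.
Qed.

(** Without overshoot the threshold quantile x satisfies z - h <= a x < z. Then x - a z <= s^2 x, so
    the rejection probability is at least [Phibar (s * x)], and shifting from s x to x yields the
    ratio exp((a x)^2 / 2). *)
Let good_ratio w : ~~ overshoot w ->
  expR ((z - h) ^+ 2 / 2) * (q * (nrej_out q f i w)%:R / m%:R)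
  <= fine (std_normal [set y : R | (f i y <= q * (nrej_out q f i w)%:R / m%:R)%R]).
Proof.
rewrite /overshoot -leNgt => gw; have lw := nrej_out_lower w im.
have rb : (0 < nrej_out q f i w <= m)%N by exact: nrej_out_bounds.
set t := q * _ / _ in gw lw *.
have tE : Phibar (xi t) = t by exact: xi_level.
set x := xi t in tE.
have xz : a * x < z.
  by rewrite mulrC -ltr_pdivlMr// ltNge -Phibar_leP -ltNge tE.
have zx : z - h <= a * x.
  by rewrite mulrC -ler_pdivrMr// -Phibar_leP tE.
have zh0 : 0 <= z - h by have := z1; have := h1; lra.
have x0 : 0 <= x by rewrite -(pmulr_rge0 _ a0) (le_trans zh0).
rewrite (_ : [set _ | _] = [set y | Phibar (a * z + s * y) <= Phibar x]); last first.
  by apply/funext => y /=; rewrite f_null// tE.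
rewrite std_normal_pval_le//=.
apply: (@le_trans _ _ (Phibar (s * x))); last first.
  apply: Phibar_le; rewrite ler_pdivrMr//.
  have -> : s * x * s = s ^+ 2 * x by ring.
  have -> : s ^+ 2 = 1 - a ^+ 2 by have := as1; lra.
  have : a * (a * x) <= a * z by rewrite ler_pM2l// ltW.
  by rewrite mulrBl mul1r expr2 -mulrA; lra.
have s1 : s <= 1.
  rewrite -(@expr_le1 _ 2)//; last exact: ltW.
  by have := as1; have := sqr_ge0 a; lra.
have d0 : 0 <= x - s * x by rewrite subr_ge0 ler_piMl.
have := Phibar_shift (s * x) d0; rewrite subrKC tE => h2.
have e : - (s * x * (x - s * x)) - (x - s * x) ^+ 2 / 2 = - ((a * x) ^+ 2 / 2).
  have -> : - (s * x * (x - s * x)) - (x - s * x) ^+ 2 / 2 = - ((1 - s ^+ 2) * x ^+ 2 / 2) by field.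
  have -> : 1 - s ^+ 2 = a ^+ 2 by have := as1; lra.
  by rewrite exprMn.
move: h2; rewrite e expRN -ler_pdivrMl ?invr_gt0 ?expR_gt0// invrK; apply: le_trans.
rewrite ler_wpM2r ?ler_expR//.
  by rewrite -tE Phibar_ge0.
by rewrite ler_pM2r// lerXn2r// nnegrE (le_trans zh0).
Qed.

(** Only the complement of overshoot is kept; there [good_ratio] divided by the number of rejections
    no longer depends on w. *)
Lemma good_term_ge :
  ((q / m%:R * expR ((z - h) ^+ 2 / 2) * (1 - 2 * (q * L)))%:E <=
   \int[iid_prob std_normal m]_w
     (std_normal [set y : R | (f i y <= q * (nrej_out q f i w)%:R / m%:R)%R]
      * ((nrej_out q f i w)%:R^-1)%:E))%E.
Proof.
set c := q / m%:R * _.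
have c0 : 0 <= c by rewrite mulr_ge0 ?expR_ge0// divr_ge0// ltW.
have mgood : measurable (~` [set w | overshoot w]) by exact: measurableC.
apply: (@le_trans _ _ (c%:E * iid_prob std_normal m (~` [set w | overshoot w]))%E).
  rewrite EFinM lee_wpmul2l ?lee_fin//.
  rewrite probability_setC// EFinB leeB//; exact: prob_overshoot.
rewrite -[X in iid_prob _ _ X]setIT -integral_indic// -ge0_integralZl_EFin//; last first.
- exact/measurable_EFinP/measurable_indic.
apply: ge0_le_integral => //.
- by move=> w _; rewrite mule_ge0// lee_fin.
- by apply/measurable_EFinP/measurable_funM => //; exact: measurable_indic.
- pose g k := fine (std_normal [set y | f i y <= q * k%:R / m%:R]) * k%:R^-1.
  rewrite (_ : (fun w => _) = EFin \o (fun w => g (nrej_out q f i w))).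
    by apply/measurable_EFinP; exact: (measurable_nrej_out q mf i g).
  apply/funext => w /=; rewrite EFinM fineK// fin_num_measure//.
  exact: (measurable_pval_le mf).
move=> w _; rewrite -EFinM indicE; have [bw|gw] := boolP (overshoot w).
  by rewrite memNset ?mulr0 ?mule_ge0 ?lee_fin//= => /(_ bw).
rewrite mem_set ?mulr1//; last exact/negP.
have /andP[r0 _] : (0 < nrej_out q f i w <= m)%N by exact: nrej_out_bounds.
rewrite -[X in (_ <= X * _)%E]fineK; last first.
  by rewrite fin_num_measure//; exact: (measurable_pval_le mf).
rewrite -EFinM lee_fin ler_pdivlMr ?ltr0n//.
apply: le_trans (good_ratio gw); rewrite /c le_eqVlt; apply/orP; left; apply/eqP.
by ring.
Qed.

End overshoot_event.

Lemma cond_FDR_ge :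
  ((q * (1 - b%:R^-1) * (expR ((z - h) ^+ 2 / 2)
      * (1 - 2 * (q * (expR (z ^+ 2 / 2) / s)))))%:E <= cond_FDR q theta coef z)%E.
Proof.
have -> : cond_FDR q theta coef z = _ :=
  @expectation_FDP _ (measurableTypeR R) R std_normal q m f q0 mf theta.
set c := _ * (1 - _ * _).
apply: (@le_trans _ _ (\sum_(i < m | ~~ (i < m1)%N) (q / m%:R * c)%:E)%E).
  rewrite sumEFin lee_fin sumr_const.
  have -> : #|[pred i : 'I_m | ~~ (i < m1)%N]| = (m - m1)%N.
    have := cardC [pred i : 'I_m | (i < m1)%N].
    rewrite card_ord_ltn ?(ltnW m1m)// card_ord => mE.
    by apply: (@addnI m1); rewrite subnKC ?(ltnW m1m)// -[RHS]mE.
  rewrite -[leRHS]mulr_natr natrB ?(ltnW m1m)// le_eqVlt; apply/orP; left; apply/eqP.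
  by rewrite /m natrM; field; rewrite bR0 andbT pnatr_eq0 -lt0n.
rewrite [leLHS]big_mkcond [leRHS]big_mkcond/=; apply: lee_sum => i _.
case: ifPn => im; last first.
  case: ifP => // _; apply: integral_ge0 => w _; rewrite mule_ge0// lee_fin.
by rewrite /theta (negbTE im) lexx /c [q / m%:R * _]mulrA; exact: good_term_ge.
Qed.
End fixed_factor.

Lemma FDR_ge (K : R) : 0 <= K -> 1 <= zmax ->
  (forall z, 1 <= z <= zmax -> K <= q * (1 - b%:R^-1) * (expR ((z - h) ^+ 2 / 2)
     * (1 - 2 * (q * (expR (z ^+ 2 / 2) / s)))) * pdf 0 1 z) ->
  K * (zmax - 1) <= FDR q theta coef.
Proof.
move=> K0 Z1 KP; rewrite -lee_fin FDR_cond// integral_std_normal; last 2 first.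
- exact: measurable_cond_FDR.
- by move=> z; exact: cond_FDR_ge0.
have mD : measurable_fun setT (fun z => (cond_FDR q theta coef z * (pdf 0 1 z)%:E)%E).
  apply: emeasurable_funM; first exact: measurable_cond_FDR.
  by apply/measurable_EFinP; exact: measurable_normal_pdf.
have D0 z : (0 <= cond_FDR q theta coef z * (pdf 0 1 z)%:E)%E.
  by rewrite mule_ge0 ?cond_FDR_ge0// lee_fin normal_pdf_ge0.
apply: (@le_trans _ _ (\int[mu]_(z in `[1%R, zmax])
    (cond_FDR q theta coef z * (pdf 0 1 z)%:E))%E); last exact: ge0_subset_integral.
have -> : (K * (zmax - 1))%:E = (\int[mu]_(z in `[1%R, zmax]) (cst K%:E z))%E.
  rewrite integral_cst// EFinM; congr (_ * _)%E.
  transitivity (mu `[1%R, zmax]%classic) => //.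
  rewrite lebesgue_measure_itv/= lte_fin.
  by case: ltgtP Z1 => [_|//|<-] _; rewrite ?subrr// -EFinB.
apply: ge0_le_integral => //.
- exact: measurable_funTS.
move=> z /=; rewrite in_itv/= => /andP[z1 zZ].
apply: (@le_trans _ _ ((q * (1 - b%:R^-1) * (expR ((z - h) ^+ 2 / 2)
     * (1 - 2 * (q * (expR (z ^+ 2 / 2) / s)))) * pdf 0 1 z)%:E)).
  by rewrite lee_fin KP// z1.
rewrite EFinM; apply: lee_wpmul2r; first by rewrite lee_fin normal_pdf_ge0.
exact: cond_FDR_ge.
Qed.

Lemma two_group_exists (K : R) : 0 <= K -> 1 <= zmax ->
  (forall z, 1 <= z <= zmax -> K <= q * (1 - b%:R^-1) * (expR ((z - h) ^+ 2 / 2)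
     * (1 - 2 * (q * (expR (z ^+ 2 / 2) / s)))) * pdf 0 1 z) ->
  exists (n : nat) (th al : 'I_n -> R),
    [/\ (0 < n)%N, forall i, -1 <= al i <= 1 & K * (zmax - 1) <= FDR q th al].
Proof.
move=> K0 Z1 KP; exists m, theta, coef; split=> //; last exact: FDR_ge.
move=> i; rewrite /coef; case: ifP => _; first by rewrite lexx/=; lra.
by apply/andP; split; have := a0; have := a2; lra.
Qed.

End lower_bound.

(** * Asymptotics *)

Section sup_FDR_bounds.
Context {R : realType}.
Local Notation pdf := (@normal_pdf R).
Local Notation peak := (Num.sqrt ((pi : R) *+ 2))^-1.
Implicit Types q zeta : R.

Lemma expRN_le (x : R) : 0 <= x -> expR (- x) <= (1 + x)^-1.
Proof.
move=> x0; rewrite expRN lef_pV2 ?posrE ?expR_gt0 ?ltr_pwDl//.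
exact: expR_ge1Dx.
Qed.

Lemma peak_gt0 : 0 < peak.
Proof. by rewrite invr_gt0 sqrtr_gt0 pmulrn_lgt0// pi_gt0. Qed.

Lemma FDR_lower zeta (q := expR (- (zeta ^+ 2 / 2))) : 12 <= zeta ->
  exists (m : nat) (theta a : 'I_m -> R),
    [/\ (0 < m)%N, forall i, -1 <= a i <= 1 & q * peak * (zeta - 12) <= FDR q theta a].
Proof.
move=> z12; have q0 : 0 < q by exact: expR_gt0.
have z0 : 0 < zeta by lra.
have q2 : q <= 2^-1.
  apply: le_trans (expRN_le _) _; first by rewrite divr_ge0 ?sqr_ge0.
  rewrite lef_pV2 ?posrE//; nra.
(* With z <= zeta this gives z h <= 1 / zeta, so the tolerance costs a factor 1 - 1 / zeta. *)
pose h := (zeta ^+ 2)^-1.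
have h0 : 0 < h by rewrite invr_gt0 exprn_gt0.
have h1 : h <= 1 by rewrite invf_le1 ?exprn_gt0//; nra.
have P0 := Phibar_gt0 (4 / h).
(* The first term keeps the proportion 1 / b of false nulls below 1 / zeta. The second forces u > 4
   / h in [slack], where a shift by h / 2 gains a factor exp(-2) <= 1/4. *)
pose B := zeta + 4 * q / Phibar (4 / h).
have B0 : 0 <= 4 * q / Phibar (4 / h) by rewrite divr_ge0 ?mulr_ge0// ltW.
pose b := (Num.truncn B).+1.
have bB : B <= b%:R by rewrite ltW// truncnS_gt.
have zb : zeta <= b%:R by rewrite (le_trans _ bB)// lerDl.
have b0 : 0 < b%:R :> R by rewrite ltr0n.
have b1 : (1 < b)%N by rewrite -(ltr_nat R); lra.
have bP : 4 * q / b%:R <= Phibar (4 / h).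
  rewrite ler_pdivrMr// [leRHS]mulrC -ler_pdivrMr//.
  by apply: le_trans bB; rewrite lerDr ltW.
have slack u : Phibar u < 4 * q / b%:R -> Phibar (u + h / 2) <= Phibar u / 4.
  move=> /lt_le_trans/(_ bP) hu.
  have {}hu : 4 / h < u by rewrite ltNge -Phibar_leP -ltNge.
  have h20 : 0 <= h / 2 by rewrite divr_ge0// ltW.
  apply: le_trans (Phibar_shift u h20) _; rewrite mulrC ler_wpM2l ?Phibar_ge0//.
  have uh : 4 < u * h by rewrite -ltr_pdivrMr.
  apply: (@le_trans _ _ (expR (- 1 + - 1))).
    by rewrite ler_expR mulrA; have := sqr_ge0 (h / 2); lra.
  have e1 : expR (- 1 : R) <= 2^-1 by have := expRN_le (@ler01 R).
  rewrite expRD (_ : 4^-1 = 2^-1 * 2^-1 :> R); last by field.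
  by rewrite ler_pM ?expR_ge0.
pose xi t : R := xget 0 [set x | Phibar x = t].
have xiP t : 0 < t <= 2^-1 -> Phibar (xi t) = t.
  move=> /Phibar_quantile[x _ xt].
  have : exists x, [set x | Phibar x = t] x by exists x.
  by move=> /(xgetPex 0).
have qb : 0 < q / b%:R <= 2^-1.
  rewrite divr_gt0//= (le_trans _ q2)// ler_pdivrMr// ler_peMr ?(ltW q0)//.
  by rewrite (le_trans _ zb)//; lra.
have [X X0 PX] := Phibar_quantile qb.
have X2 : 0 < 2 + X by lra.
pose a := (2 + X)^-1.
have a0 : 0 < a by rewrite invr_gt0.
have a2 : a <= 2^-1 by rewrite lef_pV2 ?posrE// lerDl.
have aX : a * X <= 1 by rewrite mulrC ler_pdivrMr//; lra.
(* Stopping one unit before zeta gives q exp(z^2 / 2) <= exp(- (zeta - 1/2)) <= 1 / zeta, which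
   makes overshoot unlikely. *)
pose zmax := zeta - 1.
have PZ := Phibar_gt0 (zmax / a).
pose m1 := (Num.truncn (4 * q / Phibar (zmax / a))).+1.
have mZ : 4 <= (b * m1)%:R / q * Phibar (zmax / a).
  have h4 : 4 * q / Phibar (zmax / a) <= m1%:R by rewrite ltW// truncnS_gt.
  rewrite mulrAC ler_pdivlMr// -ler_pdivrMr// (le_trans h4)// ler_nat.
  by rewrite leq_pmull// ltnW.
(* The two factors 1 - 1 / zeta pay for the false nulls and for the tolerance h; 1 - 8 / zeta pays
   for overshoot. *)
pose K := q * peak * ((1 - zeta^-1) ^+ 2 * (1 - 8 / zeta)).
have w12 : zeta^-1 <= 12^-1 by rewrite lef_pV2 ?posrE//; lra.
have w0 : 0 < zeta^-1 by rewrite invr_gt0.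
have K0 : 0 <= K.
  rewrite !mulr_ge0 ?(ltW q0) ?(ltW peak_gt0) ?sqr_ge0//; lra.
have as1 : a ^+ 2 + Num.sqrt (1 - a ^+ 2) ^+ 2 = 1.
  by rewrite sqr_sqrtr; [ring|nra].
have s2 : 2^-1 <= Num.sqrt (1 - a ^+ 2).
  rewrite -(@ler_sqr _ 2^-1) ?nnegrE ?sqrtr_ge0//.
  have aa : a ^+ 2 <= 2^-1 * 2^-1 by rewrite expr2 ler_pM ?(ltW a0).
  by move: as1; rewrite [2^-1 ^+ 2]expr2; lra.
have [||n [th [al [n0 al1 H]]]] := @two_group_exists R q h a X zmax b m1 xi
  q0 q2 b1 isT a0 a2 h0 h1 xiP PX aX slack mZ K K0.
- by rewrite /zmax; lra.
- move=> z /andP[z1]; rewrite /zmax => zZ; set s := Num.sqrt _ in s2 *.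
  have A1 : 1 - zeta^-1 <= 1 - b%:R^-1 by rewrite lerD2l lerN2 lef_pV2 ?posrE.
  have A2 : 1 - 8 / zeta <= 1 - 2 * (q * (expR (z ^+ 2 / 2) / s)).
    rewrite lerD2l lerN2 (_ : 2 * (q * _) = 2 * (q * expR (z ^+ 2 / 2) / s)); last by ring.
    have E : q * expR (z ^+ 2 / 2) <= zeta^-1.
      rewrite /q -expRD.
      have zz : z ^+ 2 <= (zeta - 1) ^+ 2 by rewrite lerXn2r ?nnegrE; lra.
      apply: (@le_trans _ _ (expR (- (zeta - 2^-1)))).
        by rewrite ler_expR; move: zz; rewrite sqrrB; lra.
      apply: le_trans (expRN_le _) _; first by lra.
      by rewrite lef_pV2 ?posrE//; lra.
    have s0 : 0 < s by apply: lt_le_trans s2; rewrite invr_gt0.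
    have si : s^-1 <= 2 by rewrite -[leRHS]invrK lef_pV2 ?posrE ?invr_gt0.
    have qe0 : 0 <= q * expR (z ^+ 2 / 2) by rewrite mulr_ge0 ?expR_ge0 ?(ltW q0).
    have si0 : 0 <= s^-1 by rewrite invr_ge0 ltW.
    by have := ler_pM qe0 si0 E si; lra.
  have A3 : peak * (1 - zeta^-1) <= expR ((z - h) ^+ 2 / 2) * pdf 0 1 z.
    rewrite pdf1E mulrCA -expRD ler_pM2l ?peak_gt0//.
    apply: le_trans (expR_ge1Dx _).
    have zh : z * h <= zeta^-1.
      have -> : zeta^-1 = zeta * h by rewrite /h; field; rewrite gt_eqF.
      by rewrite ler_pM2r//; lra.
    rewrite sqrrB; have := sqr_ge0 h; lra.
  rewrite /K (_ : q * peak * _ =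
    q * (1 - zeta^-1) * ((1 - 8 / zeta) * (peak * (1 - zeta^-1)))); last by ring.
  rewrite [leRHS](_ : _ = q * (1 - b%:R^-1) * ((1 - 2 * (q * (expR (z ^+ 2 / 2) / s))) *
    (expR ((z - h) ^+ 2 / 2) * pdf 0 1 z))); last by ring.
  have p0 := peak_gt0.
  apply: ler_pM.
  + by rewrite mulr_ge0 ?(ltW q0)//; lra.
  + by rewrite !mulr_ge0 ?(ltW p0)//; lra.
  + by rewrite ler_pM2l.
  + apply: ler_pM => //; [lra|by rewrite mulr_ge0 ?(ltW p0)//; lra].
exists n, th, al; split=> //; apply: le_trans H.
rewrite /K -[leRHS]mulrA ler_wpM2l ?mulr_ge0 ?(ltW q0) ?(ltW peak_gt0)//.
have -> : zeta - 12 = zeta * (1 - 12 * zeta^-1) by field; rewrite gt_eqF.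
have -> : zmax - 1 = zeta * (1 - 2 * zeta^-1) by rewrite /zmax; field; rewrite gt_eqF.
rewrite [leRHS]mulrCA ler_pM2l//; move: w0 w12; move: zeta^-1 => w w0 w12.
(* The relative losses 2 w (interval), 2 w (square) and 8 w (overshoot) add up to 12 w, with w = 1 /
   zeta. *)
have h2 : (1 - 2 * w) * (1 - 2 * w) <= (1 - w) ^+ 2 * (1 - 2 * w).
  by rewrite ler_wpM2r; nra.
nra.
Qed.

Section small_level.
Variable q : R.
Hypotheses (q0 : 0 < q) (q1 : q < 1).

Let zeta := Num.sqrt (2 * ln q^-1).

Lemma lnV_ge0 : 0 <= ln q^-1.
Proof. by rewrite ln_ge0// invf_ge1// ltW. Qed.

Lemma expR_level : expR (- (zeta ^+ 2 / 2)) = q.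
Proof.
rewrite sqr_sqrtr ?mulr_ge0 ?lnV_ge0// (_ : 2 * _ / 2 = ln q^-1); last by field.
by rewrite lnV ?posrE// opprK lnK.
Qed.

Lemma leading_term : q * Num.sqrt (ln q^-1) / Num.sqrt pi = q * peak * zeta.
Proof.
have -> : Num.sqrt ((pi : R) *+ 2) = Num.sqrt 2 * Num.sqrt pi.
  by rewrite -[pi *+ 2]mulr_natl sqrtrM ?ler0n.
have -> : zeta = Num.sqrt 2 * Num.sqrt (ln q^-1) by rewrite /zeta sqrtrM.
by field; rewrite !gt_eqF// sqrtr_gt0// pi_gt0.
Qed.

(** The exact quantile x of q is at most zeta, because [Phibar zeta] <= exp(- zeta^2 / 2) = q. *)
Lemma FDR_upper m (theta a : 'I_m -> R) : q <= 2^-1 -> (0 < m)%N ->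
  (forall i, -1 <= a i <= 1) -> FDR q theta a <= q * (3 + peak * zeta).
Proof.
move=> q2 m0 a1; have qi : 0 < q <= 2^-1 by rewrite q0.
have [x x0 xq] := Phibar_quantile qi.
apply: le_trans (FDR_le _ q0 m0 xq x0 a1) _.
rewrite ler_pM2l// lerD2l ler_pM2l ?peak_gt0// -Phibar_leP xq.
rewrite -[leRHS]expR_level -mulNr; apply: Phibar_le_exp.
exact: sqrtr_ge0.
Qed.

(** A real [sup] is informative only for a nonempty bounded set: the upper estimate supplies the
    bound, the construction of [FDR_lower] a member. *)
Lemma sup_FDR_itv : 12 <= zeta ->
  q * peak * (zeta - 12) <= sup_FDR q <= q * (3 + peak * zeta).
Proof.
move=> z12.
have q2 : q <= 2^-1.
  rewrite -expR_level; apply: le_trans (expRN_le _) _; first by rewrite divr_ge0 ?sqr_ge0.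
  rewrite lef_pV2 ?posrE//; nra.
have := FDR_lower z12; rewrite expR_level => -[m [theta [a [m0 a1 H]]]].
rewrite /sup_FDR; set A := [set x | _].
have Aub : ubound A (q * (3 + peak * zeta)).
  by move=> x [n [th [al [n0 al1 ->]]]]; exact: FDR_upper.
have AF : A (FDR q theta a) by exists m, theta, a; split.
apply/andP; split.
  apply: le_trans H _; apply: ub_le_sup => //; by exists (q * (3 + peak * zeta)).
by apply: ge_sup => //; exists (FDR q theta a).
Qed.

(** 3 q is the excess of the upper bound over the leading term, 12 peak q the deficit of the lower
    bound. *)
Let C : R := 3 + 12 * peak.

Lemma sup_FDR_dist : 12 <= zeta ->
  `|sup_FDR q - q * Num.sqrt (ln q^-1) / Num.sqrt pi| <= C * q.
Proof.
move=> /sup_FDR_itv/andP[lo up]; rewrite leading_term ler_distl.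
have qp : 0 < q * peak by rewrite mulr_gt0// peak_gt0.
move: lo up qp; rewrite /C; move: peak zeta (sup_FDR q) => p z S lo up qp.
by apply/andP; split; have := q0; lra.
Qed.

(** The remainder is [Phibar zeta], and Mills' bound gives zeta [Phibar zeta] <= 2 phi(zeta) = 2
    peak q. As zeta tends to infinity this is o(q). *)
Lemma ell_le_dist : 0 < zeta ->
  `|ell_le q - (q * Num.sqrt (ln q^-1) / Num.sqrt pi + q / 2)| <= 2 * peak / zeta * q.
Proof.
move=> z0; rewrite /ell_le addrAC subrr add0r ger0_norm ?Phibar_ge0//.
rewrite mulrAC ler_pdivlMr// mulrC (le_trans (Phibar_Mills z0))//.
by rewrite pdf1E mulNr expR_level mulrA.
Qed.

End small_level.

Lemma near_small_level (M : R) :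
  \forall q \near (0 : R)^'+, [/\ 0 < q, q < 1 & M <= Num.sqrt (2 * ln q^-1)].
Proof.
near=> q; have q0 : 0 < q by near: q; exact: nbhs_right_gt.
have qM : q < expR (- (M ^+ 2 / 2)) by near: q; apply: nbhs_right_lt; exact: expR_gt0.
have q1 : q < 1.
  by apply: lt_le_trans qM _; rewrite expR_le1 oppr_le0 divr_ge0 ?sqr_ge0.
split=> //; apply: le_trans (ler_norm M) _.
rewrite -sqrtr_sqr ler_sqrt ?mulr_ge0 ?lnV_ge0//.
have : ln q <= - (M ^+ 2 / 2) by rewrite -ler_expR lnK ?posrE// ltW.
by rewrite lnV ?posrE//; lra.
Unshelve. all: by end_near. Qed.

End sup_FDR_bounds.

Theorem corollary4p5 (R : realType) :
  [/\ @sup_FDR R =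
        (fun q => q * Num.sqrt (ln q^-1) / Num.sqrt pi) +O_ (0^'+) id,
      @ell_le R =
        (fun q => q * Num.sqrt (ln q^-1) / Num.sqrt pi + q / 2) +o_ (0^'+) id
    & sup_FDR q / (q * Num.sqrt (ln q^-1)) @[q --> (0 : R)^'+]
        --> (Num.sqrt pi)^-1].
Proof.
pose peak : R := (Num.sqrt (pi *+ 2))^-1.
pose C : R := 3 + 12 * peak.
have C0 : 0 < C by rewrite addr_gt0// mulr_gt0// peak_gt0.
split.
- apply/eqaddOP; apply/bigO_exP; exists C => //.
  near=> q; have [q0 q1 z12] : [/\ 0 < q, q < 1 & 12 <= Num.sqrt (2 * ln q^-1)].
    by near: q; exact: near_small_level.
  by rewrite [X in _ <= _ * X]gtr0_norm//; exact: sup_FDR_dist.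
- apply/eqaddoP => e e0.
  near=> q; have [q0 q1 zM] : [/\ 0 < q, q < 1 &
      Num.max 1 (2 * peak / e) <= Num.sqrt (2 * ln q^-1)].
    by near: q; exact: near_small_level.
  move: zM; rewrite ge_max => /andP[z1 zM].
  have z0 : 0 < Num.sqrt (2 * ln q^-1) by exact: lt_le_trans z1.
  rewrite [X in _ <= _ * X]gtr0_norm//; apply: le_trans (ell_le_dist q0 q1 z0) _.
  by rewrite ler_pM2r// ler_pdivrMr// [leRHS]mulrC -ler_pdivrMr.
apply/cvgrPdist_le => e e0.
near=> q; have [q0 q1 zM] : [/\ 0 < q, q < 1 & Num.max 12 (2 * C / e) <= Num.sqrt (2 * ln q^-1)].
  by near: q; exact: near_small_level.
move: zM; rewrite ge_max => /andP[z12 zM].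
have L0 : 0 < Num.sqrt (ln q^-1).
  by rewrite sqrtr_gt0 ln_gt0// invf_gt1.
(* Combined with zeta >= 2 C / e, this yields C <= e sqrt(log(1/q)), so the error C q is at most e
   times the normalisation. *)
have zL : Num.sqrt (2 * ln q^-1) <= 2 * Num.sqrt (ln q^-1).
  rewrite sqrtrM// ler_pM2r// -[leRHS]ger0_norm// -sqrtr_sqr ler_sqrt//; lra.
have D := sup_FDR_dist q0 q1 z12; rewrite -/peak -/C in D.
have -> : (Num.sqrt pi)^-1 - sup_FDR q / (q * Num.sqrt (ln q^-1)) =
   - (sup_FDR q - q * Num.sqrt (ln q^-1) / Num.sqrt pi) / (q * Num.sqrt (ln q^-1)).
  have spi : 0 < Num.sqrt (pi : R) by rewrite sqrtr_gt0 pi_gt0.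
  by field; rewrite !gt_eqF.
rewrite mulNr normrN normrM normfV (gtr0_norm (mulr_gt0 q0 L0)) ler_pdivrMr ?mulr_gt0//.
apply: le_trans D _; rewrite [leLHS]mulrC [leRHS]mulrCA ler_pM2l//.
by move: (le_trans zM zL); rewrite ler_pdivrMr//; lra.
Unshelve. all: by end_near. Qed.
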